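(* Each of the following problems admits a deterministic Direct-WTER: Maximum Matching, Minimum Vertex Cover, $k$-Clique Detection, $k$-Clique Counting, Max-Clique, Max-Cut, Minimum Dominating Set, and $H$-Subgraph Detection restricted to input graphs with $m=\tilde{O}(n)$ edges and to pattern graphs $H$ that contain no pendant vertex.
   Context: All graphs are finite, simple and undirected; $n$ and $m$ denote the number of vertices and edges of the input graph. For $S\subseteq V$, $\mathrm{vol}(S)=\sum_{v\in S}\deg(v)$ and $e(S,V\setminus S)$ is the number of edges with exactly one endpoint in $S$. The conductance of a cut $S$ is $\phi(S)=e(S,V\setminus S)/\min(\mathrm{vol}(S),\mathrm{vol}(V\setminus S))$ (defined as $0$ if the minimum is $0$), and the conductance of $G$ is $\phi_G=\min_{\emptyset\neq S\subsetneq V}\phi(S)$. $G$ is a $\phi$-expander if $\phi_G\ge\phi$; a family of graphs consists of $\Omega(1)$-expanders if they are all $c$-expanders for one absolute constant $c>0$. $\tilde O(\cdot)$ hides polylogarithmic factors. A deterministic direct worst-case to expander-case self-reduction (deterministic Direct-WTER) for a graph problem $\mathcal{A}$ is a deterministic algorithm that, given any instance $G$ with $n$ vertices and $m$ edges, computes in $\tilde{O}(n+m)$ time a graph $G_{exp}=(V_{exp},E_{exp})$ such that: $G_{exp}$ is an $\Omega(1)$-expander; $|V_{exp}|\le K(n,m)$ and $|E_{exp}|\le M(n,m)$ for some bounding functions $K,M$ (the blowup); and the solution $\mathcal{A}(G)$ can be computed from $\mathcal{A}(G_{exp})$ in $\tilde{O}(n+m)$ time. Problems: Maximum Matching — compute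 the maximum size of a set of pairwise disjoint edges; Minimum Vertex Cover — the minimum size of a vertex set touching every edge; $k$-Clique Detection / Counting — decide whether $G$ contains a clique on $k$ vertices / count such cliques; Max-Clique — the largest $k$ such that $G$ contains a $k$-clique; Max-Cut — $\max_{S\subseteq V}e(S,V\setminus S)$; Minimum Dominating Set — the minimum size of $D\subseteq V$ such that every vertex is in $D$ or adjacent to $D$; $H$-Subgraph Detection — for a fixed graph $H$, decide whether $G$ contains a (not necessarily induced) subgraph isomorphic to $H$. A pendant vertex is a vertex of degree $1$. *)

(* Defs.v *)
From HB Require Import structures.
From mathcomp Require Import all_boot all_order all_algebra.

Set Implicit Arguments.
Unset Strict Implicit.
Unset Printing Implicit Defensive.

Import Order.TTheory GRing.Theory Num.Theory.

(** * Graphs *)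

Record sgraph := SGraph {
  nv : nat;
  adj : rel 'I_nv;
  adj_sym : symmetric adj;
  adj_irrefl : irreflexive adj
}.

Notation vertex G := 'I_(nv G).

Definition edges (G : sgraph) : {set {set vertex G}} :=
  [set [set p.1; p.2] | p in [set p : vertex G * vertex G | adj p.1 p.2]].

Definition ne (G : sgraph) : nat := #|edges G|.

Definition deg (G : sgraph) (v : vertex G) : nat := #|[set u | adj v u]|.

Definition vol (G : sgraph) (S : {set vertex G}) : nat := \sum_(v in S) deg v.

Definition cut_size (G : sgraph) (S : {set vertex G}) : nat :=
  #|[set e in edges G | #|e :&: S| == 1]|.

(** Division by 0 in [rat] gives 0, which is the convention for cuts one side
    of which has volume 0. *)
Definition cut_conductance (G : sgraph) (S : {set vertex G}) : rat :=
  ((cut_size S)%:R / (minn (vol S) (vol (~: S)))%:R)%R.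

(** [cut_conductance S <= 1] for every [S], so the default value 1 of the
    iterated minimum matters only for graphs without any nontrivial cut, i.e.
    with at most one vertex. *)
Definition conductance (G : sgraph) : rat :=
  \big[Num.min/1%R]_(S : {set vertex G} | (S != set0) && (S != setT))
    cut_conductance S.

Definition expander (c : rat) (G : sgraph) : Prop := (c <= conductance G)%R.

(** * Graph problems

    The solution of an instance is a natural number; decision problems have
    solution 0 or 1. *)

Definition problem := sgraph -> nat.

Definition max_matching : problem := fun G =>
  \max_(M : {set {set vertex G}} | (M \subset edges G) && trivIset M) #|M|.

Definition vertex_cover (G : sgraph) (S : {set vertex G}) : bool :=
  [forall e in edges G, e :&: S != set0].

Definition min_vertex_cover : problem := fun G =>
  #|[arg min_(S < [set: vertex G] | vertex_cover S) #|S|]|.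

Definition clique (G : sgraph) (K : {set vertex G}) : bool :=
  [forall u in K, forall v in K, (u != v) ==> adj u v].

Definition clique_detection (k : nat) : problem := fun G =>
  [exists K : {set vertex G}, clique K && (#|K| == k)].

Definition clique_counting (k : nat) : problem := fun G =>
  #|[set K : {set vertex G} | clique K && (#|K| == k)]|.

Definition max_clique : problem := fun G =>
  \max_(K : {set vertex G} | clique K) #|K|.

Definition max_cut : problem := fun G =>
  \max_(S : {set vertex G}) cut_size S.

Definition dominating (G : sgraph) (D : {set vertex G}) : bool :=
  [forall v, (v \in D) || [exists u in D, adj u v]].

Definition min_dominating_set : problem := fun G =>
  #|[arg min_(D < [set: vertex G] | dominating D) #|D|]|.

Definition subgraph_detection (H : sgraph) : problem := fun G =>
  [exists f : {ffun vertex H -> vertex G},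
    injectiveb f && [forall u, forall v, adj u v ==> adj (f u) (f v)]].

Definition no_pendant (H : sgraph) : Prop :=
  forall v : vertex H, deg v <> 1.

(** * Model of computation

    Deterministic random access machines under the logarithmic cost criterion,
    programmed in a structured language.  The memory consists of arrays of
    natural numbers; a program, being a fixed finite term, can name only
    finitely many arrays, but the cells of an array are addressed by computed
    values.  Every operation is charged the bit length of its operands and its
    result, and every memory access also that of the address, so arithmetic on
    large numbers is never free. *)

Definition store := nat -> nat -> nat.

Inductive binop := Add | Sub | Mul | Div | Mod | Lt | Eq.

Inductive exp :=
  | Cst of nat
  | Get of nat & exp          (* [Get a i]: cell [i] of array [a] *)
  | Op of binop & exp & exp.

Inductive cmd :=
  | Skip
  | Set_ of nat & exp & exp   (* [Set_ a i e]: cell [i] of array [a] := [e] *)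
  | Seq of cmd & cmd
  | If of exp & cmd & cmd
  | While of exp & cmd.

Definition bits (x : nat) : nat := (trunc_log 2 x).+1.

Definition binop_val (o : binop) (x y : nat) : nat :=
  match o with
  | Add => x + y | Sub => x - y | Mul => x * y
  | Div => x %/ y | Mod => x %% y | Lt => x < y | Eq => x == y
  end.

Fixpoint val_exp (st : store) (e : exp) : nat :=
  match e with
  | Cst c => c
  | Get a i => st a (val_exp st i)
  | Op o e1 e2 => binop_val o (val_exp st e1) (val_exp st e2)
  end.

Fixpoint cost_exp (st : store) (e : exp) : nat :=
  bits (val_exp st e) +
  match e with
  | Cst _ => 0
  | Get _ i => cost_exp st i
  | Op _ e1 e2 => cost_exp st e1 + cost_exp st e2
  end.

Definition update (st : store) (a i x : nat) : store :=
  fun a' i' => if (a' == a) && (i' == i) then x else st a' i'.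

(** [exec c st t st']: started on [st], [c] halts after time [t] on [st']. *)
Inductive exec : cmd -> store -> nat -> store -> Prop :=
  | exec_skip st : exec Skip st 1 st
  | exec_set a i e st :
      exec (Set_ a i e) st (cost_exp st i + cost_exp st e)
        (update st a (val_exp st i) (val_exp st e))
  | exec_seq c1 c2 st1 t1 st2 t2 st3 :
      exec c1 st1 t1 st2 -> exec c2 st2 t2 st3 ->
      exec (Seq c1 c2) st1 (t1 + t2) st3
  | exec_if_true e c1 c2 st t st' :
      val_exp st e != 0 -> exec c1 st t st' ->
      exec (If e c1 c2) st (cost_exp st e + t) st'
  | exec_if_false e c1 c2 st t st' :
      val_exp st e = 0 -> exec c2 st t st' ->
      exec (If e c1 c2) st (cost_exp st e + t) st'
  | exec_while_true e c st1 t1 st2 t2 st3 :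
      val_exp st1 e != 0 -> exec c st1 t1 st2 -> exec (While e c) st2 t2 st3 ->
      exec (While e c) st1 (cost_exp st1 e + t1 + t2) st3
  | exec_while_false e c st :
      val_exp st e = 0 -> exec (While e c) st (cost_exp st e) st.

(** A function is in [O~(x)] if it is bounded by [softO C d x] for some
    constants [C] and [d]. *)
Definition softO (C d x : nat) : nat := C * (x.+1 * bits x ^ d).

(** * Representation of graphs in memory *)

(** [s] lists every edge once, in an arbitrary order and orientation. *)
Definition edge_list (G : sgraph) (s : seq (vertex G * vertex G)) : Prop :=
  size s = ne G /\
  forall u v, adj u v = ((u, v) \in s) || ((v, u) \in s).

(** Array 0 contains the numbers of vertices and edges, arrays 1 and 2 the
    endpoints of the edges; everything else is 0. *)
Definition graph_store (G : sgraph) (s : seq (vertex G * vertex G)) : store :=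
  fun a i =>
    match a with
    | 0 => nth 0 [:: nv G; ne G] i
    | 1 => nth 0 [seq nat_of_ord p.1 | p <- s] i
    | 2 => nth 0 [seq nat_of_ord p.2 | p <- s] i
    | _ => 0
    end.

(** In an output, only the cells that are part of the representation count. *)
Definition represents (st : store) (G : sgraph) : Prop :=
  exists2 s : seq (vertex G * vertex G), edge_list s &
    [/\ st 0 0 = nv G, st 0 1 = ne G &
        forall i, i < ne G ->
          st 1 i = graph_store s 1 i /\ st 2 i = graph_store s 2 i].

Definition answer_store (n m x : nat) : store :=
  fun a i => if a == 0 then nth 0 [:: n; m; x] i else 0.

(** * Deterministic direct worst-case to expander-case self-reductions *)

(** [reduce] maps instances in [I] to [Omega(1)]-expanders in [J], and [decode]
    computes the solution of [G] from [n], [m] and the solution of [Gexp]. *)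
Definition direct_WTER_on (I J : sgraph -> Prop) (A : problem) : Prop :=
  exists (reduce decode : cmd) (c : rat) (K M : nat -> nat -> nat) (C d : nat),
    (0 < c)%R /\
    forall (G : sgraph) (s : seq (vertex G * vertex G)),
      I G -> edge_list s ->
      exists Gexp : sgraph,
        [/\ exists t st, [/\ exec reduce (graph_store s) t st,
                             t <= softO C d (nv G + ne G)
                           & represents st Gexp],
            J Gexp /\ expander c Gexp,
            nv Gexp <= K (nv G) (ne G),
            ne Gexp <= M (nv G) (ne G)
          & exists t st,
              [/\ exec decode (answer_store (nv G) (ne G) (A Gexp)) t st,
                  t <= softO C d (nv G + ne G)
                & st 0 0 = A G]].

Definition direct_WTER (A : problem) : Prop :=
  direct_WTER_on (fun _ => True) (fun _ => True) A.

Definition sparse (C d : nat) (G : sgraph) : Prop := ne G <= softO C d (nv G).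

(** Self-reduction for [A] restricted to graphs with [m = O~(n)] edges: whatever
    the polylogarithmic factor in the bound on the inputs, the outputs again
    satisfy a bound of this form. *)
Definition sparse_direct_WTER (A : problem) : Prop :=
  forall C d, exists C' d', direct_WTER_on (sparse C d) (sparse C' d') A.

(* Main.v *)
Require Import Defs.
From mathcomp Require Import all_boot all_order all_algebra zify.

(** Add to [G] a root [r] with a pendant neighbour and, for every end of every
    edge of [G] and once more for every vertex, a copy of a fixed connected
    pattern that joins this vertex to [r].  A set [S] that avoids [r] loses an
    edge in every copy that it meets, and the number of copies at [v] exceeds
    the degree of [v], so the volume of [S] is at most a constant times its
    cut: the result is an [Omega(1)]-expander of linear size, without any use of
    explicit expander constructions.

    The pattern is chosen such that the solution changes in a predictable way.
    With the path [v - x - z - r], a vertex [y] adjacent to [x] and [z], and a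
    pendant vertex [y'] at [y], every copy adds 2 to the matching and vertex
    cover numbers, 1 to the domination number and 5 to the maximum cut, and the
    root adds 1 more.  With long paths, no new vertex lies in a small
    subgraph all of whose vertices have two neighbours in it; this preserves
    cliques on at least three vertices and subgraphs without pendant vertices. *)

Set Implicit Arguments.
Unset Strict Implicit.
Unset Printing Implicit Defensive.

Import Order.TTheory GRing.Theory Num.Theory.

(** * Graphs given by edge lists *)

(** The number of copies, $2m+n$, depends on [n] and [m] only, so the decoder can subtract their
    contribution without seeing $G$. The start of a copy is read off the two endpoint arrays, so no
    degree is ever computed. The pendant neighbour of the root makes the root a vertex that an
    optimal cover or dominating set may be assumed to contain, and gives it a private matching edge,
    at a fixed cost of 1.

    A bare path from $v$ to $r$ would not do for cuts: whether all of its edges can be cut depends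
    on the sides of $v$ and $r$. The triangle $x,y,z$ loses one edge anyway and absorbs this parity.
    For domination, $y'$ calls for $y$, which takes care of $x$ and $z$ as well, so a copy asks
    nothing of $v$; among the new vertices only an $x$ can help $v$, and $v$ itself does that at
    least as well.

    What the answer on the new graph cannot show is recovered from [n] and [m]: cliques on one or
    two vertices, and whether $G$ has room for the isolated vertices of $H$, which may land on new
    vertices. *)

Lemma edgesP (G : sgraph) (e : {set vertex G}) :
  reflect (exists u v, adj u v /\ e = [set u; v]) (e \in edges G).
Proof.
apply: (iffP imsetP) => [[[u v]]|[u [v [uv ->]]]].
  by rewrite inE => uv ->; exists u, v.
by exists (u, v); rewrite ?inE.
Qed.

Lemma adj_neq (G : sgraph) (u v : vertex G) : adj u v -> u != v.
Proof. by apply: contraL => /eqP->; rewrite adj_irrefl. Qed.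

Section EdgeList.
Variables (G : sgraph) (s : seq (vertex G * vertex G)).
Hypothesis sG : edge_list s.

Let pair2 (p : vertex G * vertex G) := [set p.1; p.2].

Lemma mem_edge_list p : p \in s -> adj p.1 p.2.
Proof. by case: p sG => u v [_ ->] ->. Qed.

Lemma edges_edge_list : edges G =i map pair2 s.
Proof.
move=> e; apply/edgesP/mapP => [[u [v [uv ->]]]|[p ps ->]].
  move: uv; rewrite (proj2 sG) => /orP[uv|vu]; first by exists (u, v).
  by exists (v, u); rewrite // /pair2 setUC.
by exists p.1, p.2; split=> //; apply: mem_edge_list.
Qed.

(** A counting argument: the list has [ne G] entries and yields all [ne G] edges, so no edge is
    yielded twice. *)
Lemma uniq_edge_list : uniq (map pair2 s).
Proof.
apply/card_uniqP; rewrite size_map (proj1 sG) /ne.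
by apply: eq_card => e; rewrite edges_edge_list.
Qed.

(** Both orientations give the same two-element set, which occurs at one position only, so the edge
    would be a loop. *)
Lemma edge_list_anti p : p \in s -> (p.2, p.1) \notin s.
Proof.
case: p => u v /= uv; apply/negP => vu.
have e0 : pair2 (u, v) = pair2 (v, u) by rewrite /pair2 setUC.
have [i lti ei] := nthP (u, v) uv; have [j ltj ej] := nthP (u, v) vu.
have := uniq_edge_list => /(uniqP set0) /(_ i j); rewrite !inE !size_map.
rewrite !(nth_map (u, v)) // ei ej => /(_ lti ltj e0) eij.
have [_ vu0] : (u, v) = (v, u) by rewrite -ei -ej eij.
by have := adj_neq (mem_edge_list uv); rewrite /= vu0 eqxx.
Qed.

Lemma cut_size_edge_list (S : {set vertex G}) :
  cut_size S = count (fun p => (p.1 \in S) (+) (p.2 \in S)) s.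
Proof.
rewrite /cut_size.
transitivity (count (fun e : {set vertex G} => #|e :&: S| == 1) (map pair2 s)).
  rewrite -size_filter -(card_uniqP (filter_uniq _ uniq_edge_list)).
  by apply: eq_card => e; rewrite inE mem_filter edges_edge_list andbC.
rewrite count_map; apply: eq_in_count => -[u v] /mem_edge_list/adj_neq /= uv.
rewrite /pair2 /= setIUl.
have I1 w : [set w] :&: S = if w \in S then [set w] else set0.
  by apply/setP => z; case: ifP => wS; rewrite !inE; case: eqP => //= ->.
rewrite !I1; case: ifP; case: ifP => _ _ /=;
  by rewrite ?setU0 ?set0U ?cards2 ?cards1 ?cards0 ?uv.
Qed.

(** Expansion only asks for an upper bound on volumes, so a degree is merely bounded by the number
    of occurrences in the list. *)
Lemma vol_edge_list (S : {set vertex G}) :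
  vol S <= \sum_(p <- s) ((p.1 \in S) + (p.2 \in S)).
Proof.
have degE v : deg v <= \sum_(p <- s) ((p.1 == v) + (p.2 == v)).
  pose t := [seq p.2 | p <- s & p.1 == v] ++ [seq p.1 | p <- s & p.2 == v].
  have sub : [set u | adj v u] \subset t.
    apply/subsetP => u; rewrite inE mem_cat (proj2 sG) => /orP[h|h].
      by apply/orP; left; apply/mapP; exists (v, u); rewrite ?mem_filter ?eqxx.
    by apply/orP; right; apply/mapP; exists (u, v); rewrite ?mem_filter ?eqxx.
  apply: leq_trans (subset_leq_card sub) _; apply: leq_trans (card_size t) _.
  by rewrite size_cat !size_map !size_filter big_split /= -!sumn_count !sumnE !big_map.
rewrite /vol; apply: (@leq_trans (\sum_(v in S) \sum_(p <- s) ((p.1 == v) + (p.2 == v)))).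
  by apply: leq_sum => v _; apply: degE.
rewrite exchange_big /=; apply: leq_sum => -[u v] _ /=; rewrite big_split /=.
suff E w : \sum_(i in S) (w == i : nat) = (w \in S) by rewrite !E.
case wS: (w \in S).
  rewrite (bigD1 w) //= eqxx big1 // => i /andP[_ /negbTE].
  by rewrite eq_sym => ->.
by rewrite big1 // => i iS; case: eqP => // wi; rewrite wi iS in wS.
Qed.

End EdgeList.

Definition list_adj N (el : seq (nat * nat)) : rel 'I_N :=
  fun u v => (u != v) && (((u : nat, v : nat) \in el) || ((v : nat, u : nat) \in el)).

Lemma list_adj_sym N el : symmetric (@list_adj N el).
Proof. by move=> u v; rewrite /list_adj eq_sym orbC. Qed.

Lemma list_adj_irrefl N el : irreflexive (@list_adj N el).
Proof. by move=> u; rewrite /list_adj eqxx. Qed.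

Definition list_graph N el : sgraph :=
  SGraph (@list_adj_sym N el) (@list_adj_irrefl N el).

Definition simple_list (el : seq (nat * nat)) : Prop :=
  uniq el /\ forall a b, (a, b) \in el -> (b, a) \notin el.

Section ListGraph.
Variables (N : nat) (el : seq (nat * nat)).
Hypothesis el_simple : simple_list el.
Hypothesis el_lt : forall a b, (a, b) \in el -> a < N.+1 /\ b < N.+1.

Let G := list_graph N.+1 el.

(** [inord] needs a nonempty ordinal type, hence the vertex number [N.+1] throughout. *)
Definition ord_list : seq (vertex G * vertex G) :=
  [seq (inord p.1 : 'I_N.+1, inord p.2 : 'I_N.+1) | p <- el].

Lemma list_graph_adj (u v : vertex G) :
  adj u v = ((u : nat, v : nat) \in el) || ((v : nat, u : nat) \in el).
Proof.
rewrite /= /list_adj; case: eqP => //= ->; rewrite orbb; apply/esym/negbTE.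
by apply/negP => vv; case/negP: ((proj2 el_simple) _ _ vv).
Qed.

Lemma mem_ord_list (u v : vertex G) :
  ((u, v) \in ord_list) = ((u : nat, v : nat) \in el).
Proof.
apply/mapP/idP => [[[a b] ab /= [-> ->]]|uv].
  by have [la lb] := el_lt ab; rewrite !inordK.
by exists (u : nat, v : nat) => //; rewrite !inord_val.
Qed.

Lemma edge_list_ord_list : edge_list ord_list.
Proof.
split=> [|u v]; last by rewrite list_graph_adj !mem_ord_list.
pose f (p : vertex G * vertex G) : {set vertex G} := [set p.1; p.2].
have ul : uniq ord_list.
  rewrite map_inj_in_uniq ?(proj1 el_simple) // => -[a b] [c d] ab cd /= [].
  have [la lb] := el_lt ab; have [lc ld] := el_lt cd.
  by move=> /(congr1 val) /=; rewrite !inordK // => ->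
    /(congr1 val) /=; rewrite !inordK // => ->.
have um : uniq (map f ord_list).
  rewrite map_inj_in_uniq // => -[a b] [c d]; rewrite !mem_ord_list => ab cd.
  rewrite /f /= => /setP E.
  have nab : a != b.
    by apply: contraTneq ab => ->; apply/negP => vv;
       case/negP: ((proj2 el_simple) _ _ vv).
  have ba := (proj2 el_simple) _ _ ab.
  have := E a; have := E b; rewrite !inE !eqxx /= orbT.
  move=> /esym/orP[]/eqP eb /esym/orP[]/eqP ea; subst => //.
  - by rewrite eqxx in nab.
  - by rewrite cd in ba.
  - by rewrite eqxx in nab.
rewrite -(size_map f) -(card_uniqP um) /ne; apply: eq_card => e; apply/esym.
apply/edgesP/mapP => [[u [v [uv ->]]]|[[u v] uv ->]].
  move: uv; rewrite list_graph_adj => /orP[uv|uv].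
    by exists (u, v); rewrite ?mem_ord_list.
  by exists (v, u); rewrite ?mem_ord_list // /f setUC.
by exists u, v; split=> //; rewrite list_graph_adj -mem_ord_list uv.
Qed.

Lemma ne_list_graph : ne G = size el.
Proof. by rewrite -(proj1 edge_list_ord_list) size_map. Qed.

Lemma cut_size_list_graph (S : {set vertex G}) :
  cut_size S =
  count (fun p => ((inord p.1 : 'I_N.+1) \in S) (+) ((inord p.2 : 'I_N.+1) \in S)) el.
Proof. by rewrite (cut_size_edge_list edge_list_ord_list) count_map. Qed.

Lemma vol_list_graph (S : {set vertex G}) :
  vol S <=
  \sum_(p <- el) (((inord p.1 : 'I_N.+1) \in S) + ((inord p.2 : 'I_N.+1) \in S)).
Proof. by have := vol_edge_list edge_list_ord_list S; rewrite big_map. Qed.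

End ListGraph.

(** * Cuts seen from a root *)

Lemma cut_size_setC (G : sgraph) (S : {set vertex G}) :
  cut_size (~: S) = cut_size S.
Proof.
apply: eq_card => e; rewrite !inE; case: edgesP => //= -[u [v [uv ->]]].
have {}uv := adj_neq uv.
rewrite -setDE; have := cardsID S [set u; v]; rewrite cards2 uv.
by case: #|_ :&: _| => [|[|[|?]]] //=; case: #|_ :\: _| => [|[|[|?]]].
Qed.

Lemma cut_size_vol (G : sgraph) (S : {set vertex G}) : 0 < cut_size S -> 0 < vol S.
Proof.
case/card_gt0P => e; rewrite inE => /andP[/edgesP[u [v [uv ->]]] /cards1P[w ws]].
have : w \in [set u; v] :&: S by rewrite ws set11.
rewrite !inE => /andP[w2 wS]; rewrite /vol (bigD1 w) //= ltn_addr //.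
apply/card_gt0P; case/orP: w2 => /eqP->; first by exists v; rewrite inE.
by exists u; rewrite inE adj_sym.
Qed.

(** A cut and its complement have the same size, and the smaller volume is at most that of either
    side, so it suffices to treat the side without the root. *)
Lemma expander_rooted (G : sgraph) (r : vertex G) (k : nat) :
  (forall S : {set vertex G}, S != set0 -> r \notin S ->
     0 < cut_size S /\ vol S <= k.+1 * cut_size S) ->
  expander (k.+1%:R^-1)%R G.
Proof.
move=> H; rewrite /expander /conductance.
(* The iterated minimum starts from 1, so the bound itself must be at most 1. *)
have c1 : (k.+1%:R^-1 <= 1 :> rat)%R by rewrite invf_le1 ?ler1n ?ltr0n.
apply: (big_ind (fun x => (k.+1%:R^-1 <= x)%R)) => //.
  by move=> x y hx hy; rewrite le_min hx hy.
move=> S /andP[S0 ST].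
have ST' : ~: S != set0 by apply: contraNneq ST => E; rewrite -(setCK S) E setC0.
have [c0 cv] : 0 < cut_size S /\ minn (vol S) (vol (~: S)) <= k.+1 * cut_size S.
  case rS: (r \in S); last first.
    have [//||h1 h2] := H S; first by rewrite rS.
    by split=> //; rewrite geq_min h2.
  have [//||h1 h2] := H (~: S); first by rewrite inE rS.
  by rewrite -cut_size_setC; split=> //; rewrite geq_min h2 orbT.
(* A positive cut makes both volumes positive, so the quotient is genuine and not the default 0. *)
rewrite /cut_conductance ler_pdivlMr ?ltr0n ?leq_min ?cut_size_vol //;
  last by rewrite ?cut_size_setC.
by rewrite mulrC ler_pdivrMr ?ltr0n // -natrM ler_nat mulnC.
Qed.

(** * Attaching copies of a pattern *)

(* A pattern with [q] inner vertices is a list of edges on [0 .. q.+1], where 0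
   stands for the vertex of the input graph at which a copy is attached and
   [q.+1] for the root common to all copies. *)

Definition inner (q a : nat) : bool := (0 < a) && (a <= q).

(** Since every edge has an inner end, copies share no edge with each other or with the input graph;
    together with the ban on opposite orientations this keeps the assembled list simple. *)
Definition pattern_ok (q : nat) (pat : seq (nat * nat)) : bool :=
  [&& uniq pat, all (fun e => (e.2, e.1) \notin pat) pat
    & all (fun e => [&& e.1 < q.+2, e.2 < q.+2 & inner q e.1 || inner q e.2]) pat].

(** Connectivity to the root, stated through cuts: the form in which the expansion proof charges
    copies. *)
Definition pattern_connected (q : nat) (pat : seq (nat * nat)) : Prop :=
  forall S : pred nat, S q.+1 = false -> forall a, a <= q -> S a ->
    has (fun e => S e.1 (+) S e.2) pat.

(** The attachment points. A vertex $v$ occurs $\deg v$ times in the first two blocks, which pay for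
    its edges, and once in the last, which reaches isolated vertices. The first two blocks are the
    input arrays, so the program can look them up. *)
Definition starts (n : nat) (sn : seq (nat * nat)) : seq nat :=
  [seq p.1 | p <- sn] ++ [seq p.2 | p <- sn] ++ iota 0 n.

(** Inner positions start at 1, so the shift [a.+1] puts the first of them at [n.+2], just after the
    root [n] and its pendant vertex [n.+1]. *)
Definition node (n q : nat) (vs : seq nat) (j a : nat) : nat :=
  if a == 0 then nth 0 vs j else if a <= q then n + j * q + a.+1 else n.

Definition pattern_copy n q vs (pat : seq (nat * nat)) j : seq (nat * nat) :=
  [seq (node n q vs j e.1, node n q vs j e.2) | e <- pat].

(* The root is [n] and its pendant vertex [n.+1]. *)
Definition attach_list n (sn : seq (nat * nat)) q pat k : seq (nat * nat) :=
  sn ++ (n, n.+1) :: flatten [seq pattern_copy n q (starts n sn) pat j | j <- iota 0 k].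

Lemma size_starts n sn : size (starts n sn) = 2 * size sn + n.
Proof. by rewrite !size_cat !size_map size_iota addnA addnn mul2n. Qed.

Lemma size_attach_list n sn q pat k :
  size (attach_list n sn q pat k) = size sn + 1 + k * size pat.
Proof.
rewrite size_cat /= size_flatten /shape -map_comp -addn1 -addnA (addnC 1); congr (_ + (_ + _)).
rewrite (eq_map (g := fun=> size pat)) => [|j]; last by rewrite /= size_map.
rewrite sumnE big_map big_const_seq iter_addn_0 mulnC; congr (_ * _).
by rewrite (eq_count (a2 := predT)) // count_predT size_iota.
Qed.

Definition nat_list (G : sgraph) (s : seq (vertex G * vertex G)) : seq (nat * nat) :=
  [seq (nat_of_ord p.1, nat_of_ord p.2) | p <- s].

Section Attach.
Variables (G : sgraph) (s : seq (vertex G * vertex G)).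
Variables (q : nat) (pat : seq (nat * nat)).
Hypothesis sG : edge_list s.

Local Notation n := (nv G).
Let sn := nat_list s.
Let vs := starts n sn.

Definition ncopies : nat := 2 * ne G + n.
Local Notation P := ncopies.

Local Notation nd := (node n q vs).

Let el := attach_list n sn q pat P.
Let N := (n + P * q).+1.

Definition attach : sgraph := list_graph N.+1 el.

Local Notation X := attach.

Lemma size_vs : size vs = P.
Proof. by rewrite size_starts size_map (proj1 sG). Qed.

Lemma vs_lt j : j < P -> nth 0 vs j < n.
Proof.
rewrite -size_vs => /(mem_nth 0); rewrite !mem_cat => /or3P[/mapP[p]|/mapP[p]|].
- by case/mapP => p' _ -> ->; apply: ltn_ord.
- by case/mapP => p' _ -> ->; apply: ltn_ord.
- by rewrite mem_iota.
Qed.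

Lemma node_inner j a : inner q a -> nd j a = n + j * q + a.+1.
Proof. by rewrite /inner /node; case: a => //= a ->. Qed.

Lemma node_root j : nd j q.+1 = n.
Proof. by rewrite /node ltnn. Qed.

Lemma inner_cases a : a <= q.+1 -> [\/ a = 0, inner q a | a = q.+1].
Proof.
rewrite leq_eqVlt ltnS => /orP[/eqP->|]; first by constructor 3.
by case: a => [|a] h; [constructor 1 | constructor 2].
Qed.

Lemma node_lt j a : j < P -> a <= q.+1 -> nd j a < N.+1.
Proof.
move=> lj /inner_cases[->|ia|->]; rewrite ?node_root /N; last by lia.
  by have /= := vs_lt lj; rewrite /node /=; lia.
rewrite node_inner //; case/andP: ia => _ aq.
have := leq_mul lj (leqnn q); rewrite mulSn; lia.
Qed.

(** Inner nodes are recognised by size alone; the disjointness proofs below reduce to this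
    comparison. *)
Lemma node_ge j a : j < P -> a <= q.+1 -> (n.+1 < nd j a) = inner q a.
Proof.
move=> lj /inner_cases[->|ia|->].
- by have := vs_lt lj; rewrite /inner /node /=; lia.
- by rewrite ia node_inner //; move: ia; rewrite /inner; lia.
- by rewrite node_root /inner ltnn; lia.
Qed.

(** Division with remainder by [q] recovers the copy and the position. An inner node is required
    because starts repeat and the root is common to all copies. *)
Lemma node_inj j j' a a' :
  j < P -> j' < P -> a <= q.+1 -> a' <= q.+1 -> inner q a ->
  nd j a = nd j' a' -> j = j' /\ a = a'.
Proof.
move=> lj lj' la la' ia E.
have ia' : inner q a' by rewrite -(node_ge lj') // -E node_ge.
move: E; rewrite !node_inner //; case/andP: ia => a0 aq; case/andP: ia' => a0' aq'.
move=> E; have {}E : j * q + a.-1 = j' * q + a'.-1 by lia.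
have q0 : 0 < q by lia.
have lt1 : a.-1 < q by lia.
have lt2 : a'.-1 < q by lia.
have := congr1 (fun x => x %/ q) E; have := congr1 (fun x => x %% q) E.
by rewrite /= !modnMDl !divnMDl // !modn_small // !divn_small //; lia.
Qed.

Lemma node_inj_copy j a a' :
  j < P -> a <= q.+1 -> a' <= q.+1 -> nd j a = nd j a' -> a = a'.
Proof.
move=> lj la la' E.
have [ia|nia] := boolP (inner q a); first by case: (node_inj lj lj la la' ia E).
have nia' : ~~ inner q a' by rewrite -(node_ge lj) // -E node_ge.
have := vs_lt lj; move: E nia nia'.
case: (inner_cases la) => ->; case: (inner_cases la') => ->;
  rewrite ?node_root /node /inner /=; lia.
Qed.

Lemma node_cases i : i < N.+1 ->
  [\/ i < n, i = n, i = n.+1 | exists j a, [/\ j < P, inner q a & i = nd j a]].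
Proof.
move=> lN; case: (ltngtP i n) => [h|h|h]; [by constructor 1| |by constructor 2].
case: (ltngtP i n.+1) => [|h'|h']; [lia| |by constructor 3].
constructor 4; have q0 : 0 < q.
  by move: lN; rewrite /N; case: (posnP q) => // ->; lia.
pose k := i - n.+2.
have kE := divn_eq k q; have kq := ltn_pmod k q0.
exists (k %/ q), (k %% q).+1; split.
- by rewrite ltn_divLR //; move: lN; rewrite /N /k; lia.
- by [].
- by rewrite node_inner //; move: kE; rewrite /k; lia.
Qed.

Definition old (u : vertex G) : vertex X := inord u.
Definition rootv : vertex X := inord n.
Definition pendv : vertex X := inord n.+1.
Definition cp (j : 'I_P) (a : nat) : vertex X := inord (nd j a).

Lemma val_old u : val (old u) = u.
Proof. by rewrite /= inordK // /N; have := ltn_ord u; lia. Qed.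

Lemma val_root : val rootv = n.
Proof. by rewrite /= inordK // /N; lia. Qed.

Lemma val_pend : val pendv = n.+1.
Proof. by rewrite /= inordK // /N; lia. Qed.

Lemma val_cp j a : a <= q.+1 -> val (cp j a) = nd j a.
Proof. by move=> la; rewrite /= inordK // node_lt. Qed.

Lemma val_cp_inner j a : inner q a -> n.+1 < val (cp j a).
Proof. by move=> /[dup] /andP[_ aq] ia; rewrite val_cp ?node_ge //; lia. Qed.

Lemma old_inj : injective old.
Proof. by move=> u v /(congr1 val); rewrite !val_old => /val_inj. Qed.

Lemma old_neq_root u : old u != rootv.
Proof. by rewrite -val_eqE val_old val_root neq_ltn ltn_ord. Qed.

Lemma old_neq_pend u : old u != pendv.
Proof. by rewrite -val_eqE val_old val_pend; have := ltn_ord u; lia. Qed.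

Lemma root_neq_pend : rootv != pendv.
Proof. by rewrite -val_eqE val_root val_pend; lia. Qed.

Lemma cp_neq_old j a u : inner q a -> cp j a != old u.
Proof.
move=> /(val_cp_inner j) lt; apply: contraTneq lt => ->.
by rewrite val_old -leqNgt; apply/leqW/ltnW.
Qed.

Lemma cp_neq_root j a : inner q a -> cp j a != rootv.
Proof.
by move=> /(val_cp_inner j) lt; apply: contraTneq lt => ->; rewrite val_root -leqNgt.
Qed.

Lemma cp_neq_pend j a : inner q a -> cp j a != pendv.
Proof.
by move=> /(val_cp_inner j) lt; apply: contraTneq lt => ->; rewrite val_pend -leqNgt.
Qed.

Lemma cp_inj j j' a a' : inner q a -> a' <= q.+1 -> cp j a = cp j' a' -> j = j' /\ a = a'.
Proof.
move=> /[dup] ia /andP[_ aq] la' /(congr1 val); rewrite !val_cp //; last by lia.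
by move=> /node_inj[]; rewrite ?ltn_ord //; [lia|move=> /val_inj].
Qed.

Lemma cp_inj_copy j a a' : a <= q.+1 -> a' <= q.+1 -> cp j a = cp j a' -> a = a'.
Proof.
by move=> la la' /(congr1 val); rewrite !val_cp // => /node_inj_copy ->.
Qed.

Lemma cp_root j : cp j q.+1 = rootv.
Proof. by apply: val_inj; rewrite val_cp // node_root val_root. Qed.

Definition start (j : 'I_P) : vertex G := Ordinal (vs_lt (ltn_ord j)).

Lemma cp_start j : cp j 0 = old (start j).
Proof. by apply: val_inj; rewrite val_cp // val_old. Qed.

(** The last block of [starts] lists all vertices in order, so index [2 * ne G + v] works, also for
    an isolated [v]. *)
Lemma start_surj v : exists j, start j = v.
Proof.
have lt : 2 * ne G + v < P by rewrite ltn_add2l.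
exists (Ordinal lt); apply: val_inj => /=.
rewrite /vs /starts !nth_cat !size_map (proj1 sG) /=.
have -> : (2 * ne G + v < ne G) = false by lia.
have -> : (2 * ne G + v - ne G < ne G) = false by lia.
have -> : 2 * ne G + v - ne G - ne G = v by lia.
by rewrite nth_iota.
Qed.

Lemma vertex_cases (x : vertex X) :
  [\/ exists u, x = old u, x = rootv, x = pendv |
      exists j a, inner q a /\ x = cp j a].
Proof.
case: (node_cases (ltn_ord x)) => [h|h|h|[j [a [lj ia h]]]].
- by constructor 1; exists (Ordinal h); apply: val_inj; rewrite val_old.
- by constructor 2; apply: val_inj; rewrite val_root.
- by constructor 3; apply: val_inj; rewrite val_pend.
- constructor 4; exists (Ordinal lj), a; split=> //.
  by apply: val_inj; rewrite val_cp //=; case/andP: ia; lia.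
Qed.

Hypothesis pat_ok : pattern_ok q pat.

Lemma pat_lt a b : (a, b) \in pat -> [/\ a <= q.+1, b <= q.+1 & inner q a || inner q b].
Proof. by case/and3P: pat_ok => _ _ /allP H /H /and3P[]. Qed.

Lemma pat_anti a b : (a, b) \in pat -> (b, a) \notin pat.
Proof. by case/and3P: pat_ok => _ /allP H _ /H. Qed.

(** The inner end determines the copy, and within one copy all nodes differ. *)
Lemma node_pair_inj j j' a b a' b' :
  j < P -> j' < P -> a <= q.+1 -> b <= q.+1 -> a' <= q.+1 -> b' <= q.+1 ->
  inner q a || inner q b ->
  nd j a = nd j' a' -> nd j b = nd j' b' -> [/\ j = j', a = a' & b = b'].
Proof.
move=> lj lj' la lb la' lb' /orP[ia|ib] E1 E2.
  have [jj aa] := node_inj lj lj' la la' ia E1; subst.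
  by split=> //; apply: node_inj_copy E2.
have [jj aa] := node_inj lj lj' lb lb' ib E2; subst.
by split=> //; apply: node_inj_copy E1.
Qed.

Lemma mem_flatten_copies x y :
  (x, y) \in flatten [seq pattern_copy n q vs pat j | j <- iota 0 P] <->
  exists j a b, [/\ j < P, (a, b) \in pat, x = nd j a & y = nd j b].
Proof.
split=> [/flatten_mapP[j]|[j [a [b [lj ab -> ->]]]]].
  rewrite mem_iota add0n => /andP[_ lj] /mapP[[a b] ab [-> ->]].
  by exists j, a, b.
apply/flatten_mapP; exists j; rewrite ?mem_iota //.
by apply/mapP; exists (a, b).
Qed.

Lemma mem_attach_list x y :
  (x, y) \in el <->
  [\/ (x, y) \in sn, x = n /\ y = n.+1 |
      exists j a b, [/\ j < P, (a, b) \in pat, x = nd j a & y = nd j b]].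
Proof.
rewrite /el mem_cat inE; split=> [/or3P[h|/eqP[-> ->]|/mem_flatten_copies h]|].
- by constructor 1.
- by constructor 2.
- by constructor 3.
case=> [->//|[-> ->]|/mem_flatten_copies ->]; first by rewrite eqxx orbT.
by rewrite !orbT.
Qed.

Lemma mem_nat_list (u v : vertex G) : ((u : nat, v : nat) \in sn) = ((u, v) \in s).
Proof.
apply/mapP/idP => [[[a b] ab /= [/val_inj-> /val_inj->]] //|uv].
by exists (u, v).
Qed.

Lemma nat_list_lt x y : (x, y) \in sn -> x < n /\ y < n.
Proof. by case/mapP => p _ [-> ->]. Qed.

Lemma attach_list_lt x y : (x, y) \in el -> x < N.+1 /\ y < N.+1.
Proof.
case/mem_attach_list => [/nat_list_lt|[-> ->]|[j [a [b [lj /pat_lt[la lb _] -> ->]]]]].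
- by rewrite /N; lia.
- by rewrite /N; lia.
- by split; apply: node_lt.
Qed.

(** Every edge of a copy has an end above [n.+1], while the root edge and the input edges have none;
    this keeps the groups apart. *)
Lemma attach_list_simple : simple_list el.
Proof.
have usn : uniq sn.
  rewrite map_inj_uniq; first exact: map_uniq (uniq_edge_list sG).
  by move=> [a b] [c d] /= [/val_inj-> /val_inj->].
have ge2 j a b : j < P -> (a, b) \in pat -> n.+1 < nd j a \/ n.+1 < nd j b.
  move=> lj /pat_lt[la lb /orP[ia|ib]]; [left|right]; by rewrite node_ge.
split.
  rewrite /el cat_uniq usn /=; apply/and3P; split.
  - apply/norP; split; first by apply/negP => /nat_list_lt; lia.
    apply/hasPn => -[x y] /mem_flatten_copies[j [a [b [lj ab -> ->]]]].
    by apply/negP => /nat_list_lt; have := ge2 _ _ _ lj ab; lia.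
  - apply/negP => /mem_flatten_copies[j [a [b [lj ab]]]].
    by have := ge2 _ _ _ lj ab; lia.
  (* The copies are the image of the product of indices and pattern edges, on which [node_pair_inj]
     gives injectivity. *)
  - apply: (allpairs_uniq (f := fun j e => (nd j e.1, nd j e.2))) (iota_uniq 0 P) _ _.
      by case/and3P: pat_ok.
    move=> [j [a b]] [j' [a' b']] /allpairsP[[j1 e1] /= [h1 h2 [-> E1]]]
      /allpairsP[[j2 e2] /= [h3 h4 [-> E2]]].
    subst; move: h1 h3; rewrite !mem_iota !add0n /= => lj lj' [F1 F2].
    have [la lb iab] := pat_lt h2; have [la' lb' _] := pat_lt h4.
    by have [-> -> ->] := node_pair_inj lj lj' la lb la' lb' iab F1 F2.
move=> x y /mem_attach_list H; apply/negP => /mem_attach_list; move: H.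
case=> [xy|[-> ->]|[j [a [b [lj ab -> ->]]]]].
- case=> [|[? ?]|[j [a [b [lj ab E1 E2]]]]].
  + case/mapP: xy => -[u v] uv [-> ->]; rewrite mem_nat_list.
    exact/negP/(edge_list_anti sG uv).
  + by have := nat_list_lt xy; lia.
  + by have := nat_list_lt xy; have := ge2 _ _ _ lj ab; lia.
- case=> [/nat_list_lt|[? ?]|[j [a [b [lj ab E1 E2]]]]]; [lia|lia|].
  by have := ge2 _ _ _ lj ab; lia.
- case=> [/nat_list_lt|[? ?]|[j' [a' [b' [lj' ab' E1 E2]]]]].
  + by have := ge2 _ _ _ lj ab; lia.
  + by have := ge2 _ _ _ lj ab; lia.
  have [la lb iab] := pat_lt ab; have [la' lb' _] := pat_lt ab'.
  have [_ ea eb] := node_pair_inj lj lj' la lb lb' la' iab E2 E1; subst.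
  by have := pat_anti ab; rewrite ab'.
Qed.

Lemma ne_attach : ne X = ne G + 1 + P * size pat.
Proof.
rewrite /X ne_list_graph; [|exact: attach_list_simple|exact: attach_list_lt].
by rewrite size_attach_list size_map (proj1 sG).
Qed.

Lemma attach_adjE (x y : vertex X) :
  adj x y = ((x : nat, y : nat) \in el) || ((y : nat, x : nat) \in el).
Proof. exact: list_graph_adj attach_list_simple _ _. Qed.

Lemma adj_old u v : adj (old u) (old v) = adj u v.
Proof.
suff E a b : ((old a : nat, old b : nat) \in el) = ((a, b) \in s).
  by rewrite attach_adjE !E (proj2 sG).
rewrite -mem_nat_list.
have := val_old a; have := val_old b; rewrite /= => -> ->.
apply/idP/idP => [/mem_attach_list|h]; last by apply/mem_attach_list; constructor 1.
have la := ltn_ord a; have lb := ltn_ord b.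
case=> // [[]|[j [c [d [lj cd]]]]]; first by lia.
have [lc ld /orP[ic|id]] := pat_lt cd.
  by move: ic; rewrite -(node_ge lj) //; lia.
by move: id; rewrite -(node_ge lj) //; lia.
Qed.

Lemma adj_root_pend : adj rootv pendv.
Proof.
rewrite attach_adjE; apply/orP; left; apply/mem_attach_list; constructor 2.
by have := val_root; have := val_pend.
Qed.

Lemma adj_cp j a b : (a, b) \in pat -> adj (cp j a) (cp j b).
Proof.
move=> ab; rewrite attach_adjE; apply/orP; left; apply/mem_attach_list; constructor 3.
by have [la lb _] := pat_lt ab; exists j, a, b; split=> //; apply: val_cp.
Qed.

Lemma adj_cases (x y : vertex X) : adj x y ->
  [\/ exists u v, [/\ adj u v, x = old u & y = old v],
      x = rootv /\ y = pendv, x = pendv /\ y = rootv |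
      exists j a b, [/\ (a, b) \in pat \/ (b, a) \in pat, x = cp j a & y = cp j b]].
Proof.
have cpE (z : vertex X) j a (lj : j < P) : a <= q.+1 ->
    z = nd j a :> nat -> z = cp (Ordinal lj) a.
  by move=> la E; apply: val_inj; rewrite val_cp.
rewrite attach_adjE => /orP[]/mem_attach_list[|[h1 h2]|[j [a [b [lj ab h1 h2]]]]].
- move=> /mapP[[u v] uv [h1 h2]]; constructor 1; exists u, v.
  by split; [exact: (mem_edge_list sG uv)|apply: val_inj; rewrite val_old..].
- by constructor 2; split; apply: val_inj; rewrite ?val_root ?val_pend.
- constructor 4; exists (Ordinal lj), a, b; have [la lb _] := pat_lt ab.
  by split; [left|apply: cpE..].
- move=> /mapP[[u v] uv [h1 h2]]; constructor 1; exists v, u; rewrite adj_sym.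
  by split; [exact: (mem_edge_list sG uv)|apply: val_inj; rewrite val_old..].
- by constructor 3; split; apply: val_inj; rewrite ?val_root ?val_pend.
- constructor 4; exists (Ordinal lj), b, a; have [la lb _] := pat_lt ab.
  by split; [right|apply: cpE..].
Qed.

Lemma cut_size_attach (S : {set vertex X}) :
  let S' i := (inord i : 'I_N.+1) \in S in
  cut_size S =
  count (fun p => S' p.1 (+) S' p.2) sn + (S' n (+) S' n.+1) +
  \sum_(j < P) count (fun e => S' (nd j e.1) (+) S' (nd j e.2)) pat.
Proof.
rewrite /= /X cut_size_list_graph;
  [|exact: attach_list_simple|exact: attach_list_lt].
rewrite /el count_cat /= addnA; congr (_ + _).
rewrite count_flatten -map_comp sumnE big_map -[P in iota 0 P]subn0.
by rewrite -/(index_iota 0 P) big_mkord; apply: eq_bigr => j _; rewrite /= count_map.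
Qed.

Lemma vol_attach (S : {set vertex X}) :
  let S' i := (inord i : 'I_N.+1) \in S in
  vol S <=
  \sum_(p <- sn) (S' p.1 + S' p.2) + (S' n + S' n.+1) +
  \sum_(j < P) \sum_(e <- pat) (S' (nd j e.1) + S' (nd j e.2)).
Proof.
have := vol_list_graph attach_list_simple attach_list_lt S.
rewrite /el big_cat big_cons /= addnA => /leq_trans; apply; rewrite leq_add2l.
rewrite big_flatten /= big_map -[P in iota 0 P]subn0 -/(index_iota 0 P) big_mkord.
by apply: leq_sum => j _; rewrite big_map.
Qed.

(** Volume is charged copy by copy. A copy that is cut pays 2 for each of its edges and 1 for one
    end of an input edge at its start, whence the constant [2 * size pat + 1]. A copy that is not
    cut is disjoint from [S] by connectivity and owes nothing. *)
Lemma attach_expander :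
  pattern_connected q pat -> expander ((2 * size pat).+1%:R^-1)%R X.
Proof.
move=> conn; apply: (expander_rooted (r := rootv)) => S S0 rS.
set K := (2 * size pat).+1.
pose S' i := (inord i : 'I_N.+1) \in S.
have S'n : S' n = false by apply: negbTE.
pose c (j : 'I_P) := count (fun e => S' (nd j e.1) (+) S' (nd j e.2)) pat.
have cpos (j : 'I_P) a : a <= q -> S' (nd j a) -> 0 < c j.
  move=> aq Sa; rewrite -has_count.
  by apply: (conn (fun b => S' (nd j b)) _ a) => //; rewrite node_root.
have cutE : cut_size S =
    count (fun p => S' p.1 (+) S' p.2) sn + S' n.+1 + \sum_(j < P) c j.
  by rewrite cut_size_attach /= -/(S' n) S'n.
split.
  rewrite cutE; case/set0Pn: S0 => x xS.
  have one j : 0 < c j -> 0 < \sum_(j < P) c j.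
    by move=> h; rewrite (bigD1 j) //= ltn_addr.
  case: (vertex_cases x) xS => [[u ->]|->|->|[j [a [ia ->]]]] xS.
  - have [j ju] := start_surj u.
    rewrite addn_gt0 (one j) ?orbT // (cpos j 0) //.
    by move: xS; rewrite -ju -cp_start.
  - by rewrite xS in rS.
  - by rewrite /S' -/pendv xS; lia.
  - by rewrite addn_gt0 (one j) ?orbT // (cpos j a) //; case/andP: ia.
have volE : vol S <= \sum_(p <- sn) (S' p.1 + S' p.2) + (S' n + S' n.+1) +
    \sum_(j < P) \sum_(e <- pat) (S' (nd j e.1) + S' (nd j e.2)).
  exact: vol_attach.
apply: leq_trans volE _; rewrite S'n add0n.
(* The ends of the input edges are the first two blocks of [starts], so each is charged to the copy
   with the same index. *)
have E : \sum_(p <- sn) (S' p.1 + S' p.2) <= \sum_(j < P) S' (nd j 0).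
  rewrite (_ : \sum_(j < P) _ = \sum_(v <- vs) S' v); last first.
    by rewrite (big_nth 0) size_vs big_mkord.
  rewrite /vs /starts !big_cat !big_map /= addnA -big_split /=.
  exact: leq_addr.
apply: (@leq_trans (S' n.+1 + \sum_(j < P)
  (S' (nd j 0) + \sum_(e <- pat) (S' (nd j e.1) + S' (nd j e.2))))).
  by rewrite [X in _ <= _ + X]big_split /= [X in X + _]addnC -addnA leq_add2l leq_add2r.
rewrite cutE !mulnDr -addnA; apply: leq_trans _ (leq_addl _ _); apply: leq_add.
  by rewrite leq_pmull.
rewrite big_distrr /=; apply: leq_sum => j _.
have [c0|cj] := posnP (c j); last first.
  apply: (@leq_trans K); last by rewrite leq_pmulr.
  have : \sum_(e <- pat) (S' (nd j e.1) + S' (nd j e.2)) <= \sum_(e <- pat) 2.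
    by apply: leq_sum => e _; case: (S' _); case: (S' _).
  rewrite big_const_seq count_predT iter_addn_0 => le2; apply: (@leq_add _ _ 1) => //.
  by case: (S' _).
have z a : a <= q.+1 -> S' (nd j a) = false.
  rewrite leq_eqVlt => /predU1P[->|aq]; first by rewrite node_root.
  by apply/negP => /(cpos j a aq); rewrite c0.
rewrite z // c0 muln0 big_seq big1 // => -[a b] /pat_lt[la lb _].
by rewrite !z.
Qed.

End Attach.

(** * Running time *)

Lemma bits_gt0 x : 0 < bits x.
Proof. by []. Qed.

Lemma bits_leP x k : 0 < k -> (bits x <= k) = (x < 2 ^ k).
Proof.
move=> k0; apply/idP/idP => [h|h].
  by apply: leq_trans (trunc_log_ltn x (ltnSn 1)) _; rewrite leq_exp2l.
case: (posnP x) => [->|x0]; first by rewrite /bits trunc_log0.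
by rewrite -(ltn_exp2l _ _ (ltnSn 1)); apply: leq_ltn_trans h; apply: trunc_logP.
Qed.

Lemma ltn_bits x : x < 2 ^ bits x.
Proof. by rewrite -bits_leP. Qed.

Lemma bits_mono x y : x <= y -> bits x <= bits y.
Proof. by move=> h; rewrite bits_leP //; apply: leq_ltn_trans h (ltn_bits y). Qed.

Lemma bits_add x y : bits (x + y) <= bits x + bits y.
Proof.
rewrite bits_leP ?addn_gt0 // expnD.
have := ltn_bits x; have := ltn_bits y.
have : 2 <= 2 ^ bits x by rewrite -{1}(expn1 2) leq_exp2l.
have : 2 <= 2 ^ bits y by rewrite -{1}(expn1 2) leq_exp2l.
nia.
Qed.

Lemma bits_mul x y : bits (x * y) <= bits x + bits y.
Proof.
by rewrite bits_leP ?addn_gt0 // expnD ltn_mul // ltn_bits.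
Qed.

Lemma bits_succ x : bits x.+1 <= 2 * bits x.
Proof. by rewrite -addn1 mul2n -addnn (leq_trans (bits_add _ _)) // leq_add2l. Qed.

(** [Sub], [Div] and [Mod] do not exceed the first operand and comparisons yield 0 or 1, so only
    sums and products need an estimate. *)
Lemma bits_binop o x y : bits (binop_val o x y) <= bits x + bits y.
Proof.
have le1 (b : bool) : bits b <= bits x + bits y by case: b; rewrite addn_gt0.
have lex z : z <= x -> bits z <= bits x + bits y.
  by move=> /bits_mono h; apply: leq_trans h (leq_addr _ _).
case: o => /=; rewrite ?le1 ?bits_add ?bits_mul //; apply: lex.
- exact: leq_subr.
- exact: leq_div.
- exact: leq_mod.
Qed.

(** A bound on the bit length of a value, in units of a common bound on the bit lengths of all
    cells. It depends on the program text only. *)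
Fixpoint val_weight (e : exp) : nat :=
  match e with
  | Cst c => bits c
  | Get _ _ => 1
  | Op _ e1 e2 => val_weight e1 + val_weight e2
  end.

Fixpoint cost_weight (e : exp) : nat :=
  val_weight e +
  match e with
  | Cst _ => 0
  | Get _ i => cost_weight i
  | Op _ e1 e2 => cost_weight e1 + cost_weight e2
  end.

Definition bounded (b : nat) (st : store) : Prop := forall a i, bits (st a i) <= b.

Lemma bits_val_exp b st e : bounded b st -> bits (val_exp st e) <= val_weight e * b.
Proof.
move=> bst; have b0 : 0 < b := leq_trans (bits_gt0 _) (bst 0 0).
elim: e => [c|a i _|o e1 IH1 e2 IH2] /=; first exact: leq_pmulr.
  by rewrite mul1n.
by rewrite mulnDl; apply: leq_trans (bits_binop _ _ _) (leq_add IH1 IH2).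
Qed.

Lemma cost_exp_leq b st e : bounded b st -> cost_exp st e <= cost_weight e * b.
Proof.
move=> bst; elim: e => [c|a i IH|o e1 IH1 e2 IH2];
  rewrite /= mulnDl; apply: leq_add; rewrite ?mulnDl ?leq_add //.
- exact: (bits_val_exp (Cst c)).
- exact: (bits_val_exp (Get a i)).
- by rewrite -mulnDl; apply: (bits_val_exp (Op o e1 e2)).
Qed.

Lemma bounded_update b st a i x :
  bounded b st -> bits x <= b -> bounded b (update st a i x).
Proof. by move=> bst hx a' i'; rewrite /update; case: ifP. Qed.

(** A Hoare triple with cost. Time is counted in units of the word length [b], and [bounded] belongs
    to the postcondition because the next command is charged against the same [b]. *)
Definition runs (b : nat) (c : cmd) (st : store) (T : nat) (Q : store -> Prop) : Prop :=
  exists t st', [/\ exec c st t st', t <= T * b, bounded b st' & Q st'].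

Section Runs.
Variable b : nat.

Lemma runs_skip st (Q : store -> Prop) : bounded b st -> Q st -> runs b Skip st 1 Q.
Proof.
move=> bst Qst; exists 1, st; split=> //; first exact: exec_skip.
by rewrite mul1n; apply: leq_trans (bits_gt0 _) (bst 0 0).
Qed.

Lemma runs_set a i e st (Q : store -> Prop) :
  bounded b st -> bits (val_exp st e) <= b ->
  Q (update st a (val_exp st i) (val_exp st e)) ->
  runs b (Set_ a i e) st (cost_weight i + cost_weight e) Q.
Proof.
move=> bst be Qst; do 2 eexists; split; first exact: exec_set.
- by rewrite mulnDl leq_add // cost_exp_leq.
- exact: bounded_update.
- exact: Qst.
Qed.

Lemma runs_seq c1 c2 st T1 T2 (Q R : store -> Prop) :
  runs b c1 st T1 Q ->
  (forall st', bounded b st' -> Q st' -> runs b c2 st' T2 R) ->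
  runs b (Seq c1 c2) st (T1 + T2) R.
Proof.
move=> [t1 [st1 [e1 l1 b1 q1]]] /(_ _ b1 q1) [t2 [st2 [e2 l2 b2 q2]]].
exists (t1 + t2), st2; split=> //; first exact: exec_seq e1 e2.
by rewrite mulnDl leq_add.
Qed.

Lemma runs_if e c1 c2 st T1 T2 (Q : store -> Prop) :
  bounded b st ->
  (val_exp st e != 0 -> runs b c1 st T1 Q) ->
  (val_exp st e = 0 -> runs b c2 st T2 Q) ->
  runs b (If e c1 c2) st (cost_weight e + (T1 + T2)) Q.
Proof.
move=> bst h1 h2; have ce := cost_exp_leq e bst.
case: (eqVneq (val_exp st e) 0) => E.
  have [t [st' [x1 x2 x3 x4]]] := h2 E.
  exists (cost_exp st e + t), st'; split=> //; first exact: exec_if_false.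
  rewrite mulnDl leq_add // mulnDl; exact: leq_trans x2 (leq_addl _ _).
have [t [st' [x1 x2 x3 x4]]] := h1 E.
exists (cost_exp st e + t), st'; split=> //; first exact: exec_if_true.
rewrite mulnDl leq_add // mulnDl; exact: leq_trans x2 (leq_addr _ _).
Qed.

Lemma runs_while e c T k (Inv : nat -> store -> Prop) :
  (forall j st, j < k -> bounded b st -> Inv j st ->
     val_exp st e != 0 /\ runs b c st T (Inv j.+1)) ->
  (forall st, Inv k st -> val_exp st e = 0) ->
  forall st, bounded b st -> Inv 0 st ->
  runs b (While e c) st (k * (cost_weight e + T) + cost_weight e) (Inv k).
Proof.
move=> step stop st bst I0.
(* Induction on the number [i] of rounds left, whereas the invariant counts the rounds done. *)
suff H i j st' : i + j = k -> bounded b st' -> Inv j st' ->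
    runs b (While e c) st' (i * (cost_weight e + T) + cost_weight e) (Inv k).
  by apply: H I0; rewrite ?addn0.
elim: i j st' => [|i IH] j st' ijk bst' Ij.
  rewrite add0n in ijk; subst j; exists (cost_exp st' e), st'; split=> //.
    exact/exec_while_false/stop.
  by rewrite mul0n cost_exp_leq.
have [|ne0 [t1 [st1 [x1 x2 x3 x4]]]] := step j st' _ bst' Ij; first by lia.
have [|t2 [st2 [y1 y2 y3 y4]]] := IH j.+1 st1 _ x3 x4; first by lia.
exists (cost_exp st' e + t1 + t2), st2; split=> //.
  exact: exec_while_true x1 y1.
rewrite mulSn -[_ + T + _ + _]addnA mulnDl leq_add //.
by rewrite mulnDl leq_add // cost_exp_leq.
Qed.

End Runs.

(** * The reduction program *)

Definition var_n : exp := Get 0 (Cst 0).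
Definition var_m : exp := Get 0 (Cst 1).
Definition var_j : exp := Get 3 (Cst 0).
Definition var_v : exp := Get 3 (Cst 1).

Definition copies_exp : exp := Op Add (Op Mul (Cst 2) var_m) var_n.

Definition node_exp (q a : nat) : exp :=
  if a == 0 then var_v
  else if a <= q then Op Add (Op Add var_n (Op Mul var_j (Cst q))) (Cst a.+1)
  else var_n.

(** The input edges keep the cells below [m], cell [m] takes the root edge, and each copy takes the
    next [g] cells. *)
Definition slot_exp (g t : nat) : exp :=
  Op Add (Op Add (Op Add var_m (Cst 1)) (Op Mul var_j (Cst g))) (Cst t).

Fixpoint emit (q g t : nat) (pat : seq (nat * nat)) : cmd :=
  if pat is e :: pat' then
    Seq (Set_ 1 (slot_exp g t) (node_exp q e.1))
      (Seq (Set_ 2 (slot_exp g t) (node_exp q e.2)) (emit q g t.+1 pat'))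
  else Skip.

Definition load_start : cmd :=
  If (Op Lt var_j var_m)
    (Set_ 3 (Cst 1) (Get 1 var_j))
    (If (Op Lt var_j (Op Mul (Cst 2) var_m))
       (Set_ 3 (Cst 1) (Get 2 (Op Defs.Sub var_j var_m)))
       (Set_ 3 (Cst 1) (Op Defs.Sub var_j (Op Mul (Cst 2) var_m)))).

Definition attach_body (q : nat) (pat : seq (nat * nat)) : cmd :=
  Seq load_start
    (Seq (emit q (size pat) 0 pat) (Set_ 3 (Cst 0) (Op Add var_j (Cst 1)))).

(** Both new counts depend on the old [n] and [m], so the new vertex number waits in a scratch cell
    until the new edge number is stored. *)
Definition attach_prog (q : nat) (pat : seq (nat * nat)) : cmd :=
  Seq (Set_ 1 var_m var_n)
    (Seq (Set_ 2 var_m (Op Add var_n (Cst 1)))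
      (Seq (While (Op Lt var_j copies_exp) (attach_body q pat))
        (Seq (Set_ 3 (Cst 2)
               (Op Add (Op Add var_n (Op Mul copies_exp (Cst q))) (Cst 2)))
          (Seq (Set_ 0 (Cst 1)
                 (Op Add (Op Add var_m (Cst 1)) (Op Mul copies_exp (Cst (size pat)))))
            (Set_ 0 (Cst 0) (Get 3 (Cst 2))))))).

Definition holds_list (st : store) (l : seq (nat * nat)) : Prop :=
  forall i, i < size l -> st 1 i = (nth (0, 0) l i).1 /\ st 2 i = (nth (0, 0) l i).2.

Lemma holds_list_rcons (st st' : store) l x :
  holds_list st l ->
  (forall i, i != size l -> st' 1 i = st 1 i /\ st' 2 i = st 2 i) ->
  st' 1 (size l) = x.1 -> st' 2 (size l) = x.2 -> holds_list st' (rcons l x).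
Proof.
move=> h fr h1 h2 i; rewrite size_rcons ltnS nth_rcons.
case: (ltngtP i (size l)) => // [lt|->] _; last by rewrite h1 h2.
by have [|-> ->] := fr i; [rewrite ltn_eqF | apply: h].
Qed.

(** * Correctness and cost of the program *)

Section Program.
Variables (n m q : nat) (pat sn : seq (nat * nat)).
Hypothesis size_sn : size sn = m.

Let vs := starts n sn.
Let P := 2 * m + n.
Let g := size pat.
(** New vertices, new edges and copies together: an upper bound for every number that the program
    stores. *)
Let top := (n + P * q).+2 + (m + 1 + P * g) + P.
Local Notation b := (bits top).

Hypothesis sn_lt : forall x y, (x, y) \in sn -> x < n /\ y < n.
Hypothesis pat_lt : forall x y, (x, y) \in pat -> x <= q.+1 /\ y <= q.+1.

Definition regs (j : nat) (st : store) : Prop :=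
  [/\ st 0 0 = n, st 0 1 = m & st 3 0 = j].

Lemma starts_lt j : j < P -> nth 0 vs j < n.
Proof.
have snP : all (fun p => (p.1 < n) && (p.2 < n)) sn.
  by apply/allP => -[x y] /sn_lt /= [-> ->].
rewrite /P -size_sn -(size_starts n) => /(mem_nth 0).
rewrite !mem_cat => /or3P[/mapP[p]|/mapP[p]|].
- by move=> /(allP snP) /andP[h _] ->.
- by move=> /(allP snP) /andP[_ h] ->.
- by rewrite mem_iota.
Qed.

Lemma node_leq_top j a : j < P -> a <= q.+1 -> node n q vs j a <= top.
Proof.
move=> lj la; rewrite /node; case: eqP => _; first by have := starts_lt lj; rewrite /top; lia.
case: ifP => aq; rewrite /top; last by lia.
by have := leq_mul lj (leqnn q); rewrite mulSn; lia.
Qed.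

Lemma val_node_exp j a st :
  regs j st -> st 3 1 = nth 0 vs j -> val_exp st (node_exp q a) = node n q vs j a.
Proof.
move=> [h0 h1 h2] hv; rewrite /node_exp /node; case: eqP => //= _.
by case: ifP => //= _; rewrite h0 h2.
Qed.

Lemma val_slot_exp j t st : regs j st -> val_exp st (slot_exp g t) = m + 1 + j * g + t.
Proof. by case=> /= _ -> ->. Qed.

Fixpoint emit_weight (t : nat) (p : seq (nat * nat)) : nat :=
  if p is e :: p' then
    cost_weight (slot_exp g t) + cost_weight (node_exp q e.1) +
    (cost_weight (slot_exp g t) + cost_weight (node_exp q e.2) + emit_weight t.+1 p')
  else 1.

Lemma runs_emit j p t l st :
  j < P -> {subset p <= pat} -> bounded b st ->
  regs j st -> st 3 1 = nth 0 vs j -> holds_list st l -> size l = m + 1 + j * g + t ->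
  runs b (emit q g t p) st (emit_weight t p)
    (fun st' => regs j st' /\ holds_list st' (l ++ pattern_copy n q vs p j)).
Proof.
move=> lj; elim: p t l st => [|[x y] p IH] t l st sub bst rst vst hl sl /=.
  by apply: runs_skip; rewrite ?cats0.
have [lx ly] : x <= q.+1 /\ y <= q.+1 by apply: pat_lt; apply: sub; rewrite mem_head.
pose st1 := update st 1 (size l) (node n q vs j x).
pose st2 := update st1 2 (size l) (node n q vs j y).
have r1 : regs j st1 by [].
have r2 : regs j st2 by [].
apply: (@runs_seq _ _ _ _ _ _ (fun st' => st' = st1)).
  apply: runs_set => //; rewrite (val_node_exp _ rst) //.
    exact/bits_mono/node_leq_top.
  by rewrite (val_slot_exp _ rst) -sl.
move=> ? /[swap] -> b1; apply: (@runs_seq _ _ _ _ _ _ (fun st' => st' = st2)).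
  apply: runs_set => //; rewrite (val_node_exp _ r1) //.
    exact/bits_mono/node_leq_top.
  by rewrite (val_slot_exp _ r1) -sl.
move=> ? /[swap] -> b2; rewrite -cat_rcons; apply: IH => //.
- by move=> z zp; apply: sub; rewrite inE zp orbT.
- apply: (holds_list_rcons hl).
  + by move=> i /negbTE ni; rewrite /st2 /st1 /update /= ni.
  + by rewrite /st2 /st1 /update /= eqxx.
  + by rewrite /st2 /st1 /update /= eqxx.
- by rewrite size_rcons sl -addnS.
Qed.

Definition load_weight : nat :=
  cost_weight (Op Lt var_j var_m) +
  (cost_weight (Cst 1) + cost_weight (Get 1 var_j) +
   (cost_weight (Op Lt var_j (Op Mul (Cst 2) var_m)) +
    (cost_weight (Cst 1) + cost_weight (Get 2 (Op Defs.Sub var_j var_m)) +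
     (cost_weight (Cst 1) + cost_weight (Op Defs.Sub var_j (Op Mul (Cst 2) var_m)))))).

(** Edges are only appended, so the first [m] cells still hold the input in every round; this is why
    the list has the form [sn ++ l]. *)
Lemma runs_load_start j l st :
  j < P -> bounded b st -> regs j st -> holds_list st (sn ++ l) ->
  runs b load_start st load_weight
    (fun st' => [/\ regs j st', st' 3 1 = nth 0 vs j & holds_list st' (sn ++ l)]).
Proof.
move=> lj bst rst hl; have [h0 h1 h2] := rst.
have fin e : val_exp st e = nth 0 vs j ->
    runs b (Set_ 3 (Cst 1) e) st (cost_weight (Cst 1) + cost_weight e)
    (fun st' => [/\ regs j st', st' 3 1 = nth 0 vs j & holds_list st' (sn ++ l)]).
  move=> E; apply: runs_set => //.
    by rewrite E; apply/bits_mono; have := starts_lt lj; rewrite /top; lia.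
have nthv : nth 0 vs j =
    if j < m then (nth (0, 0) sn j).1
    else if j < 2 * m then (nth (0, 0) sn (j - m)).2 else j - 2 * m.
  rewrite /vs /starts !nth_cat !size_map size_sn.
  case: ltnP => jm; first by rewrite (nth_map (0, 0)) ?size_sn.
  have -> : (j - m < m) = (j < 2 * m) by lia.
  case: ltnP => jm2; first by rewrite (nth_map (0, 0)) // size_sn; lia.
  by rewrite nth_iota; move: lj; rewrite /P; lia.
have get i : i < m -> st 1 i = (nth (0, 0) sn i).1 /\ st 2 i = (nth (0, 0) sn i).2.
  by move=> im; have := hl i; rewrite size_cat nth_cat size_sn im; apply; lia.
rewrite /load_start /load_weight; apply: runs_if => //=; rewrite h1 h2.
  rewrite eqb0 negbK => jm; apply: fin; rewrite nthv jm /= h2.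
  by case: (get j jm).
move/eqP; rewrite eqb0 => njm; apply: runs_if => //=; rewrite h1 h2.
  rewrite eqb0 negbK => jm2; apply: fin; rewrite nthv (negbTE njm) jm2 /= h1 h2.
  by case: (get (j - m)); first by lia.
move/eqP; rewrite eqb0 => njm2; apply: fin.
by rewrite nthv (negbTE njm) (negbTE njm2) /= h1 h2.
Qed.

Lemma attach_listS k :
  attach_list n sn q pat k.+1 = attach_list n sn q pat k ++ pattern_copy n q vs pat k.
Proof.
by rewrite /attach_list -(addn1 k) iotaD map_cat flatten_cat /= cats0 -catA.
Qed.

Definition body_weight : nat :=
  load_weight + (emit_weight 0 pat + (cost_weight (Cst 0) + cost_weight (Op Add var_j (Cst 1)))).

Let Inv j st := regs j st /\ holds_list st (attach_list n sn q pat j).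

Lemma runs_body j st : j < P -> bounded b st -> Inv j st ->
  runs b (attach_body q pat) st body_weight (Inv j.+1).
Proof.
move=> lj bst [rst hst]; apply: runs_seq; first exact: (runs_load_start lj bst rst hst).
move=> st1 b1 [r1 v1 h1]; apply: runs_seq.
  apply: (runs_emit lj _ b1 r1 v1 h1) => //.
  by rewrite (size_attach_list n sn q pat j) size_sn addn0.
move=> st2 b2 [r2 h2]; apply: runs_set => //=; case: r2 => e0 e1 e2; rewrite e2.
  by apply: bits_mono; rewrite /top; lia.
by split; [split=> //=; rewrite addn1 | rewrite attach_listS].
Qed.

Definition tail_weight : nat :=
  cost_weight (Cst 2) +
  cost_weight (Op Add (Op Add var_n (Op Mul copies_exp (Cst q))) (Cst 2)) +
  (cost_weight (Cst 1) +
   cost_weight (Op Add (Op Add var_m (Cst 1)) (Op Mul copies_exp (Cst g))) +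
   (cost_weight (Cst 0) + cost_weight (Get 3 (Cst 2)))).

Definition prog_weight : nat :=
  cost_weight var_m + cost_weight var_n +
  (cost_weight var_m + cost_weight (Op Add var_n (Cst 1)) +
   (P * (cost_weight (Op Lt var_j copies_exp) + body_weight) +
    cost_weight (Op Lt var_j copies_exp) + tail_weight)).

Lemma runs_attach_prog st :
  bounded b st -> regs 0 st -> holds_list st sn ->
  runs b (attach_prog q pat) st prog_weight
    (fun st' => [/\ st' 0 0 = (n + P * q).+2, st' 0 1 = m + 1 + P * g &
                    holds_list st' (attach_list n sn q pat P)]).
Proof.
move=> bst rst hst; have [e0 e1 e2] := rst.
pose st1 := update st 1 m n; pose st2 := update st1 2 m n.+1.
apply: (@runs_seq _ _ _ _ _ _ (fun st' => st' = st1)).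
  by apply: runs_set => //=; rewrite e0 ?e1 //; apply: bits_mono; rewrite /top; lia.
move=> ? /[swap] -> b1; apply: (@runs_seq _ _ _ _ _ _ (fun st' => st' = st2)).
  by apply: runs_set => //=; rewrite /st1 /update /= e0 addn1 ?e1 //;
    apply: bits_mono; rewrite /top; lia.
move=> ? /[swap] -> b2; apply: (@runs_seq _ _ _ _ _ _ (Inv P)).
  apply: runs_while => //.
  - move=> j st' lj b' I'; split; last exact: runs_body.
    by case: I' => -[/= -> -> ->] _; rewrite lj.
  - by move=> st' [[/= -> -> ->] _]; rewrite ltnn.
  split=> //; rewrite /attach_list /= cats1; apply: (holds_list_rcons hst).
  + by rewrite size_sn => i /negbTE ni; rewrite /st2 /st1 /update /= ni.
  + by rewrite size_sn /st2 /st1 /update /= eqxx.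
  + by rewrite size_sn /st2 /st1 /update /= eqxx.
move=> st3 b3 [[f0 f1 f2] h3].
pose st4 := update st3 3 2 (n + P * q).+2.
pose st5 := update st4 0 1 (m + 1 + P * g).
apply: (@runs_seq _ _ _ _ _ _ (fun st' => st' = st4)).
  by apply: runs_set => //=; rewrite f0 f1 -/P addn2 //; apply: bits_mono; rewrite /top; lia.
move=> ? /[swap] -> b4; apply: (@runs_seq _ _ _ _ _ _ (fun st' => st' = st5)).
  apply: runs_set => //=; rewrite /st4 /update /= f0 f1 -/P //.
  by apply: bits_mono; rewrite /top; lia.
move=> ? /[swap] -> b5; apply: runs_set => //=.
Qed.


(** [prog_weight] with one round of the loop in place of [P], so that [P.+1] times this constant
    bounds it. *)
Definition prog_const : nat :=
  cost_weight var_m + cost_weight var_n +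
  (cost_weight var_m + cost_weight (Op Add var_n (Cst 1)) +
   (cost_weight (Op Lt var_j copies_exp) + body_weight +
    cost_weight (Op Lt var_j copies_exp) + tail_weight)).

Definition size_const : nat := 2 * (q + g) + 6.

Lemma top_leq : top <= size_const * (n + m).+1.
Proof. by clear size_sn sn_lt pat_lt; rewrite /top /size_const /P; nia. Qed.

Lemma prog_weight_softO :
  prog_weight * b <= softO (2 * prog_const * (bits size_const + 2)) 1 (n + m).
Proof.
clear size_sn sn_lt pat_lt.
(* The bound on [top] involves [(n + m).+1]; the summand 2 pays for the passage to [n + m] by
   [bits_succ]. *)
have bb : b <= (bits size_const + 2) * bits (n + m).
  apply: leq_trans (bits_mono top_leq) _; apply: leq_trans (bits_mul _ _) _.
  by rewrite mulnDl leq_add ?leq_pmulr // bits_succ.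
have ww : prog_weight <= (2 * (n + m).+1) * prog_const.
  apply: (@leq_trans (P.+1 * prog_const)); last by rewrite leq_mul2r /P; lia.
  rewrite /prog_weight /prog_const; move: body_weight tail_weight => x y.
  move: (cost_weight _) (cost_weight _) (cost_weight _) (cost_weight _) => c1 c2 c3 c4.
  by nia.
apply: leq_trans (leq_mul ww bb) _; rewrite /softO expn1.
by rewrite [X in X * _ <= _]mulnAC mulnACA.
Qed.

End Program.

(** * Reductions by attaching a pattern *)

Lemma softO_leq C C' d x : C <= C' -> softO C d x <= softO C' d x.
Proof. by move=> h; rewrite leq_mul2r h orbT. Qed.

Lemma attach_represents (G : sgraph) (s : seq (vertex G * vertex G)) q pat (st : store) :
  edge_list s -> pattern_ok q pat ->
  st 0 0 = nv (attach s q pat) -> st 0 1 = ne (attach s q pat) ->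
  holds_list st (attach_list (nv G) (nat_list s) q pat (ncopies G)) ->
  represents st (attach s q pat).
Proof.
move=> sG ok h0 h1 hl.
have simp := attach_list_simple sG ok; have lt := attach_list_lt sG ok.
exists (ord_list _ _); first exact: (edge_list_ord_list simp lt).
split=> // i; rewrite (ne_list_graph simp lt) => li.
have [-> ->] := hl i li; rewrite /graph_store -!map_comp.
rewrite !(nth_map (0, 0)) //=.
move: (mem_nth (0, 0) li); case: (nth _ _ i) => a b /lt[l1 l2] /=.
by rewrite !inordK.
Qed.

Lemma exec_attach_prog (G : sgraph) (s : seq (vertex G * vertex G)) q pat :
  edge_list s -> pattern_ok q pat ->
  exists t st, [/\ exec (attach_prog q pat) (graph_store s) t st,
    t <= softO (2 * prog_const q pat * (bits (size_const q pat) + 2)) 1 (nv G + ne G)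
    & represents st (attach s q pat)].
Proof.
move=> sG ok.
have sz : size (nat_list s) = ne G by rewrite size_map (proj1 sG).
have slt x y : (x, y) \in nat_list s -> x < nv G /\ y < nv G by apply: nat_list_lt.
have plt x y : (x, y) \in pat -> x <= q.+1 /\ y <= q.+1 by case/(pat_lt ok).
have ltV (l : seq (vertex G)) i : nth 0 (map (@nat_of_ord _) l) i <= nv G.
  have [li|li] := ltnP i (size l); last by rewrite nth_default ?size_map.
  have : nth 0 (map (@nat_of_ord _) l) i \in map (@nat_of_ord _) l.
    by rewrite mem_nth ?size_map.
  by case/mapP => u _ ->; apply: ltnW.
set tp := (nv G + (2 * ne G + nv G) * q).+2
  + (ne G + 1 + (2 * ne G + nv G) * size pat) + (2 * ne G + nv G).
have bst : bounded (bits tp) (graph_store s).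
  move=> a i; apply: bits_mono; rewrite /tp.
  case: a => [|[|[|a]]] //=.
  - by case: i => [|[|i]] /=; rewrite ?nth_nil; lia.
  - rewrite (map_comp (@nat_of_ord _) fst); apply: leq_trans (ltV _ i) _; lia.
  - rewrite (map_comp (@nat_of_ord _) snd); apply: leq_trans (ltV _ i) _; lia.
have rst : regs (nv G) (ne G) 0 (graph_store s) by [].
have hst : holds_list (graph_store s) (nat_list s).
  move=> i; rewrite size_map => li; rewrite /graph_store /nat_list.
  have [p0 _] : exists p0 : vertex G * vertex G, true.
    by case: (s) li => // p0; exists p0.
  by rewrite !(nth_map p0).
have [t [st [h1 h2 _ [h3 h4 h5]]]] := runs_attach_prog sz slt plt bst rst hst.
exists t, st; split=> //; first exact: leq_trans h2 (prog_weight_softO _ _ _ _).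
by apply: attach_represents => //; rewrite ?ne_attach.
Qed.

(** Reduces a problem to a decoder that is a single expression in [n], [m] and the new answer;
    running time, size and expansion depend on the pattern only. The bound on [A] admits answers of
    exponential value, such as clique counts. *)
Lemma attach_WTER (I J : sgraph -> Prop) (A : problem) q pat (dec : exp) :
  pattern_ok q pat -> pattern_connected q pat ->
  (forall X, A X <= 2 ^ (nv X + ne X)) ->
  (forall G (s : seq (vertex G * vertex G)), edge_list s -> J (attach s q pat)) ->
  (forall G (s : seq (vertex G * vertex G)), edge_list s ->
     val_exp (answer_store (nv G) (ne G) (A (attach s q pat))) dec = A G) ->
  direct_WTER_on I J A.
Proof.
move=> ok conn bA jA dA.
set C1 := 2 * prog_const q pat * (bits (size_const q pat) + 2).
set C2 := (cost_weight (Cst 0) + cost_weight dec) * size_const q pat.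
exists (attach_prog q pat), (Set_ 0 (Cst 0) dec), ((2 * size pat).+1%:R^-1)%R,
  (fun n m => (n + (2 * m + n) * q).+2), (fun n m => m + 1 + (2 * m + n) * size pat),
  (C1 + C2), 1.
split=> [|G s _ sG]; first by rewrite invr_gt0 ltr0n.
exists (attach s q pat); split=> //.
- have [t [st [h1 h2 h3]]] := exec_attach_prog sG ok; exists t, st; split=> //.
  by apply: leq_trans h2 (softO_leq _ _ (leq_addr _ _)).
- by split; [apply: jA | apply: attach_expander].
- by rewrite ne_attach.
set X := attach s q pat; set ans := answer_store _ _ _.
have nX : nv X = (nv G + (2 * ne G + nv G) * q).+2 by [].
have mX : ne X = ne G + 1 + (2 * ne G + nv G) * size pat by apply: ne_attach.
(* Here the word length is linear in the size of the new graph, since the answer alone can be that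
   long. This is affordable because the decoder evaluates one fixed expression. *)
have bans : bounded (nv X + ne X).+1 ans.
  move=> a i; rewrite bits_leP // expnS mul2n -addnn.
  have n1 : nv G <= nv X by rewrite nX -addn2 -addnA leq_addr.
  have m1 : ne G <= ne X by rewrite mX -addnA leq_addr.
  have := bA X; have := ltn_expl (nv X + ne X) (ltnSn 1).
  rewrite /ans /answer_store -/X; move: (2 ^ _) => w; clear mX nX.
  case: a => [|a] /=; last by lia.
  by case: i => [|[|[|i]]] /=; rewrite ?nth_nil; lia.
exists (cost_exp ans (Cst 0) + cost_exp ans dec), (update ans 0 0 (val_exp ans dec)).
split; [exact: exec_set | | by rewrite /update /=; apply: dA].
apply: (@leq_trans (softO C2 1 (nv G + ne G))); last exact: softO_leq (leq_addl _ _).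
apply: leq_trans (leq_add (cost_exp_leq _ bans) (cost_exp_leq _ bans)) _.
rewrite -mulnDl /softO /C2 -mulnA leq_mul2l; apply/orP; right.
apply: (@leq_trans (size_const q pat * (nv G + ne G).+1)).
  by rewrite nX mX /size_const; nia.
by rewrite leq_mul2l leq_pmulr ?orbT // expn_gt0.
Qed.

(** * Matchings, vertex covers and dominating sets *)

(** Disjoint sets meet [W] in different points. *)
Lemma card_trivIset_hitting (T : finType) (M : {set {set T}}) (W : {set T}) :
  trivIset M -> (forall e, e \in M -> e :&: W != set0) -> #|M| <= #|W|.
Proof.
move=> tM hit; apply: (@leq_trans (\sum_(x in cover M | x \in W) 1)).
  rewrite big_trivIset_cond // -sum1_card; apply: leq_sum => e /hit.
  case/set0Pn => x /setIP[xe xW]; rewrite (bigD1 x) //= xe //.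
by rewrite sum1_card; apply: subset_leq_card; apply/subsetP => x /andP[].
Qed.

Lemma vertex_coverP (G : sgraph) (S : {set vertex G}) :
  reflect (forall u v, adj u v -> u \in S \/ v \in S) (vertex_cover S).
Proof.
apply: (iffP forall_inP) => [H u v uv|H e /edgesP[u [v [uv ->]]]].
  have : [set u; v] \in edges G by apply/edgesP; exists u, v.
  by move/H/set0Pn => [x]; rewrite !inE => /andP[/orP[]/eqP-> ->]; [left|right].
case: (H u v uv) => h; apply/set0Pn; first by exists u; rewrite !inE eqxx.
by exists v; rewrite !inE eqxx orbT.
Qed.

Lemma min_vertex_coverP (G : sgraph) :
  (exists2 S : {set vertex G}, vertex_cover S & #|S| = min_vertex_cover G) /\
  (forall S : {set vertex G}, vertex_cover S -> min_vertex_cover G <= #|S|).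
Proof.
rewrite /min_vertex_cover; case: arg_minnP => [|S cS minS]; last by split; [exists S|].
by apply/vertex_coverP => u v _; left; rewrite inE.
Qed.

Lemma dominatingP (G : sgraph) (D : {set vertex G}) :
  reflect (forall v, v \in D \/ exists2 u, u \in D & adj u v) (dominating D).
Proof.
apply: (iffP forallP) => H v; first by case/orP: (H v) => [|/exists_inP]; [left|right].
by case: (H v) => [->|/exists_inP ->] //; rewrite orbT.
Qed.

Lemma min_dominating_setP (G : sgraph) :
  (exists2 D : {set vertex G}, dominating D & #|D| = min_dominating_set G) /\
  (forall D : {set vertex G}, dominating D -> min_dominating_set G <= #|D|).
Proof.
rewrite /min_dominating_set; case: arg_minnP => [|D dD minD]; last by split; [exists D|].
by apply/dominatingP => v; left; rewrite inE.
Qed.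

(** * Extensions by hubs with private leaves *)

Section Hubs.
Variables (G X : sgraph) (f : vertex G -> vertex X).
Variables (I : finType) (hub leaf : I -> vertex X).
Hypothesis f_inj : injective f.
Hypothesis f_adj : forall u v, adj (f u) (f v) = adj u v.
Hypothesis hub_inj : injective hub.
Hypothesis leaf_inj : injective leaf.
Hypothesis hub_leaf : forall i j, hub i != leaf j.
Hypothesis f_hub : forall u i, f u != hub i.
Hypothesis f_leaf : forall u i, f u != leaf i.
Hypothesis adj_hub_leaf : forall i, adj (hub i) (leaf i).

Let spoke i : {set vertex X} := [set hub i; leaf i].
Let M1 := [set spoke i | i in [set: I]].
Let W := [set hub i | i in [set: I]].

Lemma disjoint_spoke i j : i != j -> [disjoint spoke i & spoke j].
Proof.
move=> ij; rewrite disjoints_subset; apply/subsetP => x.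
rewrite !inE => /orP[]/eqP->; apply/norP; split.
- by rewrite (inj_eq hub_inj).
- exact: hub_leaf.
- by rewrite eq_sym; apply: hub_leaf.
- by rewrite (inj_eq leaf_inj).
Qed.

Lemma spoke_inj : injective spoke.
Proof.
move=> i j E; apply/eqP; apply: contraT => /disjoint_spoke; rewrite E -setI_eq0 setIid.
by move/eqP/setP/(_ (hub j)); rewrite !inE eqxx.
Qed.

Lemma card_spokes : #|M1| = #|I|.
Proof. by rewrite card_imset ?cardsT //; apply: spoke_inj. Qed.

Lemma trivIset_spokes : trivIset M1.
Proof.
apply/trivIsetP => _ _ /imsetP[i _ ->] /imsetP[j _ ->] ne.
by apply: disjoint_spoke; apply: contraNneq ne => ->.
Qed.

Lemma card_hubs : #|W| = #|I|.
Proof. by rewrite card_imset ?cardsT. Qed.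

Lemma f_spoke u i : f u \notin spoke i.
Proof. by rewrite !inE negb_or f_hub f_leaf. Qed.

Section Cover.
Hypothesis adj_hub : forall x y, adj x y ->
  (exists u v, x = f u /\ y = f v) \/ (exists i, x = hub i \/ y = hub i).

(** At most [#|I|] edges of a matching meet a hub, and the others come from a matching of [G].
    Conversely, all spokes can be added to a matching of [G]. *)
Lemma max_matching_hubs : max_matching X = max_matching G + #|I|.
Proof.
apply/eqP; rewrite eqn_leq; apply/andP; split.
  apply/bigmax_leqP => M /andP[/subsetP Msub tM].
  pose MG := [set e in edges G | f @: e \in M].
  pose MW := [set e in M | e :&: W != set0].
  have sub : M \subset [set f @: (e : {set vertex G}) | e in MG] :|: MW.
    apply/subsetP => e eM; have /edgesP[x [y [xy E]]] := Msub e eM.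
    case: (adj_hub xy) => [[u [v [Ex Ey]]]|[i Ei]]; rewrite in_setU; apply/orP.
      left; apply/imsetP; exists [set u; v]; last by rewrite imsetU !imset_set1 -Ex -Ey.
      rewrite inE imsetU !imset_set1 -Ex -Ey -E eM andbT.
      by apply/edgesP; exists u, v; rewrite -f_adj -Ex -Ey.
    right; rewrite inE eM; apply/set0Pn; exists (hub i).
    by rewrite inE imset_f ?inE // E !inE; case: Ei => ->; rewrite eqxx ?orbT.
  apply: leq_trans (subset_leq_card sub) _; apply: leq_trans (leq_card_setU _ _) _.
  apply: leq_add.
    apply: leq_trans (leq_imset_card _ _) _.
    apply: (leq_bigmax_cond (F := fun M : {set {set vertex G}} => #|M|)).
    apply/andP; split; first by apply/subsetP => e; rewrite inE => /andP[].
    apply/trivIsetP => A B; rewrite !inE => /andP[_ A1] /andP[_ B1] AB.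
    have /(trivIsetP tM _ _ A1 B1) : f @: A != f @: B by rewrite (inj_eq (imset_inj f_inj)).
    rewrite -!setI_eq0 => /eqP /setP d; apply/eqP/setP => u; rewrite !inE.
    by have := d (f u); rewrite !inE !mem_imset.
  rewrite -card_hubs; apply: card_trivIset_hitting => [|e]; last by rewrite inE => /andP[].
  by apply: trivIsetS tM; apply/subsetP => e; rewrite inE => /andP[].
have H (M : {set {set vertex G}}) : (M \subset edges G) && trivIset M ->
    #|M| + #|I| <= max_matching X.
  case/andP => /subsetP Msub tM.
  pose fM := [set f @: (e : {set vertex G}) | e in M].
  have d : [disjoint fM & M1].
    rewrite disjoints_subset; apply/subsetP => _ /imsetP[e _ ->]; rewrite inE.
    apply/negP => /imsetP[i _ /setP/(_ (hub i))]; rewrite !inE eqxx.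
    by move=> /imsetP[u _ /eqP]; rewrite eq_sym (negbTE (f_hub u i)).
  have -> : #|M| + #|I| = #|fM :|: M1|.
    rewrite cardsU -card_spokes (card_imset _ (imset_inj f_inj)).
    by move: d; rewrite -setI_eq0 => /eqP->; rewrite cards0 subn0.
  apply: (leq_bigmax_cond (F := fun M : {set {set vertex X}} => #|M|)).
  apply/andP; split.
    apply/subsetP => e /setUP[/imsetP[e' /Msub/edgesP[u [v [uv ->]]] ->]|/imsetP[i _ ->]].
      by apply/edgesP; exists (f u), (f v); rewrite f_adj imsetU !imset_set1.
    by apply/edgesP; exists (hub i), (leaf i).
  have fspoke e i : [disjoint f @: (e : {set vertex G}) & spoke i].
    rewrite disjoints_subset; apply/subsetP => _ /imsetP[u _ ->].
    by rewrite inE f_spoke.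
  apply/trivIsetP => A B /setUP[/imsetP[A' A1 ->]|A1] /setUP[/imsetP[B' B1 ->]|B1] AB.
  - have A'B' : A' != B' by apply: contraNneq AB => ->.
    have := trivIsetP tM _ _ A1 B1 A'B'; rewrite -!setI_eq0 => /eqP d'.
    apply/eqP; rewrite -imsetI ?d' ?imset0 // => ? ? _ _; exact: f_inj.
  - by case/imsetP: B1 => i _ ->.
  - by case/imsetP: A1 => i _ ->; rewrite disjoint_sym.
  - exact: (trivIsetP trivIset_spokes).
(* The case of the empty matching; it excludes truncation in the subtraction that follows. *)
have h0 : #|I| <= max_matching X.
  rewrite -[#|I|]add0n -(cards0 {set vertex G}); apply: H; rewrite sub0set.
  by apply/trivIsetP => A B; rewrite inE.
suff : max_matching G <= max_matching X - #|I| by lia.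
by apply/bigmax_leqP => M /H; lia.
Qed.

(** The hubs cover every new edge, and no cover avoids a spoke. A cover of [X] is split into its
    part in the image of [f], which covers [G], and the rest, which hits every spoke. *)
Lemma min_vertex_cover_hubs : min_vertex_cover X = min_vertex_cover G + #|I|.
Proof.
have [[SX cX EX] minX] := min_vertex_coverP X.
have [[SG cG EG] minG] := min_vertex_coverP G.
apply/eqP; rewrite eqn_leq; apply/andP; split.
  apply: (@leq_trans #|f @: SG :|: W|); last first.
    apply: leq_trans (leq_card_setU _ _) _; rewrite card_hubs leq_add2r -EG.
    exact: leq_imset_card.
  apply: minX; apply/vertex_coverP => x y xy.
  case: (adj_hub xy) => [[u [v [Ex Ey]]]|[i]].
    subst; move: xy; rewrite f_adj => /(vertex_coverP _ cG).
    by case=> h; [left|right]; rewrite inE imset_f.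
  by case=> ->; [left|right]; rewrite inE orbC imset_f ?inE.
pose S0 := [set u | f u \in SX]; pose S1 := SX :\: f @: [set: vertex G].
have c0 : vertex_cover S0.
  by apply/vertex_coverP => u v; rewrite -f_adj !inE => /(vertex_coverP _ cX).
have c1 : #|I| <= #|S1|.
  rewrite -card_spokes; apply: card_trivIset_hitting trivIset_spokes _.
  move=> _ /imsetP[i _ ->]; apply/set0Pn.
  have fN x : x \in spoke i -> x \notin f @: [set: vertex G].
    by move=> xi; apply: contraL xi => /imsetP[u _ ->]; apply: f_spoke.
  case: (vertex_coverP _ cX _ _ (adj_hub_leaf i)) => h.
    by exists (hub i); rewrite !inE h fN ?inE ?eqxx.
  by exists (leaf i); rewrite !inE h fN ?inE ?eqxx ?orbT.
have E : f @: S0 = SX :&: f @: [set: vertex G].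
  apply/setP => x; apply/imsetP/setIP => [[u + ->]|[xS /imsetP[u _ xu]]].
    by rewrite inE => ->; rewrite imset_f ?inE.
  by exists u; rewrite ?inE -?xu.
have := cardsID (f @: [set: vertex G]) SX; rewrite -E card_imset // -/S1 EX => <-.
by rewrite leq_add // minG.
Qed.

End Cover.

(* In a dominating set of [X], a vertex outside [G] that dominates vertices of
   [G] can be replaced by its owner. *)
Section Dominate.
Variable owner : vertex X -> option (vertex G).
Hypothesis dominated : forall x, (exists u, x = f u) \/ (exists i, x = hub i \/ adj (hub i) x).
Hypothesis adj_leaf : forall x i, adj x (leaf i) -> x = hub i.
Hypothesis owner_f : forall u, owner (f u) = Some u.
Hypothesis owner_hub : forall i, owner (hub i) = None.
Hypothesis owner_leaf : forall i, owner (leaf i) = None.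
Hypothesis owner_adj : forall x v, adj x (f v) ->
  exists2 w, owner x = Some w & w = v \/ adj w v.

Lemma min_dominating_set_hubs : min_dominating_set X = min_dominating_set G + #|I|.
Proof.
have [[DX dX EX] minX] := min_dominating_setP X.
have [[DG dG EG] minG] := min_dominating_setP G.
apply/eqP; rewrite eqn_leq; apply/andP; split.
  apply: (@leq_trans #|f @: DG :|: W|); last first.
    apply: leq_trans (leq_card_setU _ _) _; rewrite card_hubs leq_add2r -EG.
    exact: leq_imset_card.
  apply: minX; apply/dominatingP => x.
  have hW i : hub i \in f @: DG :|: W by rewrite inE orbC imset_f ?inE.
  case: (dominated x) => [[u ->]|[i [->|ix]]]; [|by left|by right; exists (hub i)].
  case: (dominatingP _ dG u) => [uD|[w wD wu]].
    by left; rewrite inE imset_f.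
  by right; exists (f w); rewrite ?f_adj // inE imset_f.
pose D0 := [set w | [exists x in DX, owner x == Some w]].
pose DN := [set x | owner x == None].
have c0 : dominating D0.
  apply/dominatingP => v; case: (dominatingP _ dX (f v)) => [vD|[x xD /owner_adj[w xw]]].
    by left; rewrite inE; apply/exists_inP; exists (f v); rewrite ?owner_f.
  have wD : w \in D0 by rewrite inE; apply/exists_inP; exists x; rewrite ?xw.
  by case=> [<-|wv]; [left|right; exists w].
(* A leaf is dominated only by itself or by its hub, and neither has an owner. *)
have c1 : #|I| <= #|DX :&: DN|.
  rewrite -card_spokes; apply: card_trivIset_hitting trivIset_spokes _.
  move=> _ /imsetP[i _ ->]; apply/set0Pn.
  case: (dominatingP _ dX (leaf i)) => [h|[x xD /adj_leaf xi]].
    by exists (leaf i); rewrite !inE h eqxx owner_leaf orbT.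
  by exists (hub i); rewrite !inE -xi xD xi eqxx owner_hub.
(* [D0] is the set of owners of members of [DX], and members with an owner are not counted in
   [c1]. *)
have c2 : #|D0| <= #|DX :\: DN|.
  rewrite -(card_imset _ (@Some_inj _)); apply: leq_trans (leq_imset_card owner _).
  apply: subset_leq_card; apply/subsetP => _ /imsetP[w + ->].
  rewrite inE => /exists_inP[x xD /eqP xw]; apply/imsetP; exists x => //.
  by rewrite !inE xD xw.
rewrite -EX -(cardsID DN DX) addnC leq_add //.
exact: leq_trans (minG _ c0) c2.
Qed.

End Dominate.
End Hubs.

(** * Cliques *)

Lemma cliqueP (G : sgraph) (K : {set vertex G}) :
  reflect (forall u v, u \in K -> v \in K -> u != v -> adj u v) (clique K).
Proof.
apply: (iffP forall_inP) => H u.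
  by move=> v uK vK uv; have /forall_inP/(_ v vK) := H u uK; rewrite uv.
by move=> uK; apply/forall_inP => v vK; apply/implyP; apply: H.
Qed.

Lemma clique_detectionE k (G : sgraph) :
  clique_detection k G = (0 < clique_counting k G).
Proof.
congr nat_of_bool; apply/existsP/card_gt0P => -[K h]; exists K; move: h; by rewrite inE.
Qed.

Lemma clique_counting0 (G : sgraph) : clique_counting 0 G = 1.
Proof.
rewrite /clique_counting (_ : [set _ | _] = [set set0]) ?cards1 //.
apply/setP => K; rewrite !inE cards_eq0; case: eqP => [->|]; rewrite ?andbF //.
by rewrite andbT; apply/cliqueP => u v; rewrite inE.
Qed.

Lemma clique1 (G : sgraph) (v : vertex G) : clique [set v].
Proof. by apply/cliqueP => u w /set1P-> /set1P->; rewrite eqxx. Qed.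

Lemma clique_counting1 (G : sgraph) : clique_counting 1 G = nv G.
Proof.
rewrite -[RHS]card_ord -cardsT -(card_imset _ set1_inj); apply: eq_card => K.
rewrite inE; apply/andP/imsetP => [[_ /cards1P[v ->]]|[v _ ->]]; first by exists v.
by rewrite clique1 cards1.
Qed.

Lemma clique2 (G : sgraph) (u v : vertex G) : adj u v -> clique [set u; v].
Proof.
move=> uv; apply/cliqueP => x y /set2P[]-> /set2P[]->; rewrite ?eqxx // => _.
by rewrite adj_sym.
Qed.

Lemma clique_counting2 (G : sgraph) : clique_counting 2 G = ne G.
Proof.
apply: eq_card => K; rewrite inE; apply/andP/edgesP => [[cK /cards2P[u [v [uv E]]]]|].
  exists u, v; split=> //; apply: (cliqueP _ cK) => //; by rewrite E !inE eqxx ?orbT.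
by case=> u [v [uv ->]]; rewrite clique2 // cards2 (adj_neq uv).
Qed.

Section Triangles.
Variables (G X : sgraph) (f : vertex G -> vertex X).
Hypothesis f_inj : injective f.
Hypothesis f_adj : forall u v, adj (f u) (f v) = adj u v.
Hypothesis triangle_f : forall x y z, adj x y -> adj y z -> adj x z -> exists u, x = f u.

Lemma clique_imset (K : {set vertex G}) : clique (f @: K) = clique K.
Proof.
apply/cliqueP/cliqueP => H u v.
  by move=> uK vK uv; rewrite -f_adj; apply: H; rewrite ?imset_f ?(inj_eq f_inj).
move=> /imsetP[a aK ->] /imsetP[b bK ->]; rewrite (inj_eq f_inj) f_adj.
exact: H.
Qed.

(** Every vertex of a clique on at least three vertices lies in a triangle. *)
Lemma clique_preimset (K : {set vertex X}) :
  clique K -> 2 < #|K| -> K = f @: (f @^-1: K).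
Proof.
move=> cK K2; apply/setP => x; apply/idP/imsetP => [xK|[u + ->]]; last by rewrite inE.
have /card_gt1P[y [z [yK zK yz]]] : 1 < #|K :\ x| by have := cardsD1 x K; rewrite xK; lia.
move: yK zK; rewrite !inE => /andP[yx yK] /andP[zx zK].
have [||| u xu] := @triangle_f x y z; try by apply: (cliqueP _ cK); rewrite // eq_sym.
by exists u; rewrite ?inE -?xu.
Qed.

Lemma clique_counting_triangles k : 2 < k -> clique_counting k X = clique_counting k G.
Proof.
move=> k2; rewrite /clique_counting -[RHS](card_imset _ (imset_inj f_inj)).
apply: eq_card => K; rewrite inE; apply/andP/imsetP => [[cK /eqP Kk]|[K']].
  have E : K = f @: (f @^-1: K) by apply: clique_preimset; rewrite ?Kk.
  exists (f @^-1: K) => //; rewrite inE -clique_imset -E cK.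
  by rewrite -(card_imset _ f_inj) -E Kk eqxx.
by rewrite inE => /andP[cK Kk] ->; rewrite clique_imset card_imset.
Qed.

(** A clique on at most two vertices of [X] may use new vertices; an edge of [G] makes up for it. *)
Lemma max_clique_triangles : 0 < ne G -> max_clique X = max_clique G.
Proof.
move=> m0; apply/eqP; rewrite eqn_leq; apply/andP; split; apply/bigmax_leqP => K cK.
  have [K2|K2] := leqP #|K| 2.
    case/card_gt0P: m0 => e /edgesP[u [v [uv _]]]; apply: leq_trans K2 _.
    have := leq_bigmax_cond (F := fun K : {set vertex G} => #|K|) _ (clique2 uv).
    by rewrite cards2 (adj_neq uv).
  have E := clique_preimset cK K2; rewrite E card_imset //.
  apply: (leq_bigmax_cond (F := fun K : {set vertex G} => #|K|)).
  by rewrite -clique_imset -E.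
rewrite -(card_imset _ f_inj).
by apply: (leq_bigmax_cond (F := fun K : {set vertex X} => #|K|)); rewrite clique_imset.
Qed.

End Triangles.

Lemma max_clique_edgeless (G : sgraph) : ne G = 0 -> max_clique G = (0 < nv G).
Proof.
move=> m0; apply/eqP; rewrite eqn_leq; apply/andP; split.
  apply/bigmax_leqP => K cK; have [n0|n0] := posnP (nv G).
    by apply: leq_trans (max_card _) _; rewrite card_ord n0.
  rewrite leqNgt; apply/negP => /card_gt1P[u [v [uK vK uv]]].
  have : [set u; v] \in edges G.
    by apply/edgesP; exists u, v; split=> //; apply: (cliqueP _ cK).
  by move: m0 => /cards0_eq ->; rewrite inE.
case: posnP => // n0.
have := leq_bigmax_cond (F := fun K : {set vertex G} => #|K|) _ (clique1 (Ordinal n0)).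
by rewrite cards1.
Qed.

(** Values may be prescribed separately on the four kinds of vertices. This yields the owner map for
    domination and the optimal side of a cut. *)
Lemma attach_rec (G : sgraph) (s : seq (vertex G * vertex G)) q pat (T : Type)
    (fo : vertex G -> T) (fr fp : T) (fc : 'I_(ncopies G) -> nat -> T) :
  edge_list s ->
  exists F : vertex (attach s q pat) -> T,
    [/\ forall u, F (old s q pat u) = fo u, F (rootv s q pat) = fr, F (pendv s q pat) = fp
      & forall j a, inner q a -> F (cp s q pat j a) = fc j a].
Proof.
move=> sG; pose code := ('I_(ncopies G) * 'I_q.+1)%type.
pose F x :=
  if [pick u | old s q pat u == x] is Some u then fo u
  else if x == rootv s q pat then fr else if x == pendv s q pat then fp
  else if [pick c : code | inner q c.2 && (cp s q pat c.1 c.2 == x)] is Some c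
  then fc c.1 c.2 else fr.
have rN : [pick u | old s q pat u == rootv s q pat] = None.
  by case: pickP => // u; rewrite (negbTE (old_neq_root _ _ _ u)).
have pN : [pick u | old s q pat u == pendv s q pat] = None.
  by case: pickP => // u; rewrite (negbTE (old_neq_pend _ _ _ u)).
exists F; split.
- move=> u; rewrite /F; case: pickP => [v /eqP/old_inj->//|/(_ u)].
  by rewrite eqxx.
- by rewrite /F rN eqxx.
- by rewrite /F pN eq_sym (negbTE (root_neq_pend _ _ _)) eqxx.
move=> j a ia; rewrite /F; case: pickP => [u|_].
  by rewrite eq_sym (negbTE (cp_neq_old _ sG _ _ ia)).
rewrite (negbTE (cp_neq_root _ sG _ ia)) (negbTE (cp_neq_pend _ sG _ ia)).
have /andP[a0 aq] := ia.
case: pickP => [[j' a'] /= /andP[ia' /eqP E]|/(_ (j, inord a)) /=].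
  by have [-> ->] := cp_inj sG ia (leqW (proj2 (andP ia'))) (esym E).
by rewrite inordK // ia eqxx.
Qed.

(** * Matching, vertex cover, maximum cut and dominating set *)

(** Here $x$, $y$, $z$, $y'$ are 1, 2, 3, 4, while 0 is $v$ and 5 is the root. *)
Definition kite : seq (nat * nat) := [:: (0, 1); (1, 2); (2, 3); (1, 3); (2, 4); (3, 5)].

Lemma kite_ok : pattern_ok 4 kite.
Proof. by []. Qed.

Lemma kite_connected : pattern_connected 4 kite.
Proof.
move=> S S5 a aq Sa; rewrite /= S5 => {S5}.
have : [|| S 0, S 1, S 2, S 3 | S 4].
  by case: a aq Sa => [|[|[|[|[|a]]]]] // _ ->; rewrite ?orbT.
by case: (S 0); case: (S 1); case: (S 2); case: (S 3); case: (S 4).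
Qed.

Section Kite.
Variables (G : sgraph) (s : seq (vertex G * vertex G)).
Hypothesis sG : edge_list s.

Let X := attach s 4 kite.
Local Notation P := (ncopies G).
Local Notation old := (old s 4 kite).
Local Notation rootv := (rootv s 4 kite).
Local Notation pendv := (pendv s 4 kite).
Local Notation cp := (cp s 4 kite).

Let cpN a b j j' : inner 4 a -> inner 4 b -> a != b -> cp j a != cp j' b.
Proof.
move=> ia ib; apply: contra => /eqP E.
by have [_ ->] := cp_inj sG ia (leqW (proj2 (andP ib))) E.
Qed.

Let cpJ a j j' : inner 4 a -> cp j a = cp j' a -> j = j'.
Proof. by move=> ia E; have [] := cp_inj sG ia (leqW (proj2 (andP ia))) E. Qed.

(** The spokes are $xz$ ([true]) and $yy'$ ([false]) in each copy, and the root edge ([None]). They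
    fit matchings and covers because every kite edge meets $x$, $y$ or the root. *)
Let hub2 (i : option ('I_P * bool)) : vertex X :=
  if i is Some (j, t) then cp j (if t then 1 else 2) else rootv.
Let leaf2 (i : option ('I_P * bool)) : vertex X :=
  if i is Some (j, t) then cp j (if t then 3 else 4) else pendv.

Lemma kite_hub2 :
  [/\ injective hub2, injective leaf2, forall i j, hub2 i != leaf2 j,
      (forall u i, old u != hub2 i) /\ (forall u i, old u != leaf2 i)
    & forall i, adj (hub2 i) (leaf2 i)].
Proof.
split.
- move=> [[j t]|] [[j' t']|] //= E.
  + case: t t' E => -[] // E; try by rewrite (cpJ _ E).
    * by have := @cpN 1 2 j j' isT isT isT; rewrite E eqxx.
    * by have := @cpN 2 1 j j' isT isT isT; rewrite E eqxx.
  + by have := @cp_neq_root _ _ 4 kite sG j (if t then 1 else 2);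
      rewrite E eqxx; case: (t) => /(_ isT).
  + by have := @cp_neq_root _ _ 4 kite sG j' (if t' then 1 else 2);
      rewrite -E eqxx; case: (t') => /(_ isT).
- move=> [[j t]|] [[j' t']|] //= E.
  + case: t t' E => -[] // E; try by rewrite (cpJ _ E).
    * by have := @cpN 3 4 j j' isT isT isT; rewrite E eqxx.
    * by have := @cpN 4 3 j j' isT isT isT; rewrite E eqxx.
  + by have := @cp_neq_pend _ _ 4 kite sG j (if t then 3 else 4);
      rewrite E eqxx; case: (t) => /(_ isT).
  + by have := @cp_neq_pend _ _ 4 kite sG j' (if t' then 3 else 4);
      rewrite -E eqxx; case: (t') => /(_ isT).
- move=> [[j t]|] [[j' t']|] /=.
  + by case: t t' => -[]; apply: cpN.
  + by case: t; apply: cp_neq_pend.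
  + by rewrite eq_sym; case: t'; apply: cp_neq_root.
  + exact: root_neq_pend.
- split=> u [[j t]|] /=; rewrite ?old_neq_root ?old_neq_pend //.
  + by rewrite eq_sym; case: t; apply: cp_neq_old.
  + by rewrite eq_sym; case: t; apply: cp_neq_old.
- move=> [[j t]|] /=; last exact: (adj_root_pend sG kite_ok).
  by case: t; apply: (adj_cp sG kite_ok).
Qed.

Lemma kite_adj_hub2 (x y : vertex X) : adj x y ->
  (exists u v, x = old u /\ y = old v) \/ (exists i, x = hub2 i \/ y = hub2 i).
Proof.
case/(adj_cases sG kite_ok) => [[u [v [_ -> ->]]]|[-> ->]|[-> ->]|[j [a [b [ab -> ->]]]]].
- by left; exists u, v.
- by right; exists None; left.
- by right; exists None; right.
right; wlog ab' : a b ab / (a, b) \in kite.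
  move=> H; case: (ab) => h; first exact: H.
  by case: (H b a (or_introl h) h) => i; exists i; rewrite or_comm.
move: ab'; rewrite !inE.
case/orP=> [/eqP[-> ->]|]; first by exists (Some (j, true)); right.
case/orP=> [/eqP[-> ->]|]; first by exists (Some (j, true)); left.
case/orP=> [/eqP[-> ->]|]; first by exists (Some (j, false)); left.
case/orP=> [/eqP[-> ->]|]; first by exists (Some (j, true)); left.
case/orP=> [/eqP[-> ->]|/eqP[-> ->]]; first by exists (Some (j, false)); left.
by exists None; right; apply: cp_root.
Qed.

Let card2 : #|{: option ('I_P * bool)}| = 2 * P + 1.
Proof. by rewrite card_option card_prod card_ord card_bool mulnC addn1. Qed.

Lemma max_matching_kite : max_matching X = max_matching G + (2 * P + 1).
Proof.
have [h1 h2 h3 [h4 h5] h6] := kite_hub2; rewrite -card2.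
apply: (max_matching_hubs (@old_inj _ s 4 kite) (adj_old sG kite_ok) h1 h2 h3 h4 h5 h6).
exact: kite_adj_hub2.
Qed.

Lemma min_vertex_cover_kite : min_vertex_cover X = min_vertex_cover G + (2 * P + 1).
Proof.
have [h1 h2 h3 [h4 h5] h6] := kite_hub2; rewrite -card2.
apply: (min_vertex_cover_hubs (@old_inj _ s 4 kite) (adj_old sG kite_ok) h1 h2 h3 h4 h5 h6).
exact: kite_adj_hub2.
Qed.

(** For domination $y$ alone serves a copy, being adjacent to $x$, $z$ and $y'$. *)
Let hub1 (i : option 'I_P) : vertex X := if i is Some j then cp j 2 else rootv.
Let leaf1 (i : option 'I_P) : vertex X := if i is Some j then cp j 4 else pendv.

Lemma min_dominating_set_kite : min_dominating_set X = min_dominating_set G + (P + 1).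
Proof.
have [h1 h2 h3 [h4 h5] h6] := kite_hub2.
(* These hubs and leaves are among those of [hub2], whose properties carry over. *)
pose emb (i : option 'I_P) := omap (fun j => (j, false)) i.
have embI : injective emb by move=> [i|] [j|] //= [->].
have hE i : hub1 i = hub2 (emb i) by case: i.
have lE i : leaf1 i = leaf2 (emb i) by case: i.
(* Among the new vertices only the nodes $x$ are adjacent to old ones, so only they have an owner,
   the start of their copy. *)
have [owner [o1 o2 o3 o4]] := attach_rec 4 kite Some None None
  (fun j a => if a == 1 then Some (start sG j) else None) sG.
have -> : P + 1 = #|{: option 'I_P}| by rewrite card_option card_ord addn1.
apply: (@min_dominating_set_hubs G X old _ hub1 leaf1 _ _ _ _ owner).
- exact: adj_old sG kite_ok.
- by move=> i j; rewrite !hE => /h1/embI.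
- by move=> i j; rewrite !lE => /h2/embI.
- by move=> i j; rewrite hE lE.
- move=> x; case: (vertex_cases sG x) => [[u ->]|->|->|[j [a [ia ->]]]].
  + by left; exists u.
  + by right; exists None; left.
  + by right; exists None; right; apply: adj_root_pend sG kite_ok.
  right; exists (Some j); rewrite [hub1 _]/(cp j 2).
  case: a ia => [|[|[|[|[|a]]]]] // _.
  + by right; rewrite adj_sym; apply: (adj_cp sG kite_ok).
  + by left.
  + by right; apply: (adj_cp sG kite_ok).
  + by right; apply: (adj_cp sG kite_ok).
- move=> x i; case/(adj_cases sG kite_ok) => [[u [v [_ _ E]]]|[Ex E]|[_ E]|[j [a [b [ab Ex E]]]]].
  + by have := h5 v (emb i); rewrite -lE E eqxx.
  + by move: E; rewrite lE => /(h2 _ None)/(embI _ None)->.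
  + by have := h3 None (emb i); rewrite -lE E eqxx.
  + case: i E => [i|] /= E; last first.
      have [la lb] : a <= 5 /\ b <= 5 by case: ab => /(pat_lt kite_ok)[].
      case: (inner_cases lb) => [b0|ib|b5].
      * by have := old_neq_pend s 4 kite (start sG j); rewrite E b0 cp_start eqxx.
      * by case/eqP: (@cp_neq_pend _ _ 4 kite sG j b ib).
      * by have := root_neq_pend s 4 kite; rewrite E b5 (cp_root _ _ sG) eqxx.
    have lb : b <= 5 by case: ab => /(pat_lt kite_ok)[].
    have [ij b4] := @cp_inj _ _ 4 kite sG i j 4 b isT lb E; subst.
    by case: ab; rewrite !inE /= ?xpair_eqE ?andbF ?orbF //= => /andP[/eqP-> _].
- exact: o1.
- by case=> [j|] /=; rewrite ?o2 ?o4.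
- by case=> [j|] /=; rewrite ?o3 ?o4.
- move=> x v; case/(adj_cases sG kite_ok) => [[u [w [uw -> /old_inj->]]]|[_ /eqP E]|[_ /eqP E]|].
  + by exists u; [apply: o1|right].
  + by rewrite (negbTE (old_neq_pend _ _ _ v)) in E.
  + by rewrite (negbTE (old_neq_root _ _ _ v)) in E.
  case=> j [a [b [ab Ex E]]].
  have lb : b <= 5 by case: ab => /(pat_lt kite_ok)[].
  case: (inner_cases lb) => [b0|ib|b5].
  + have a1 : a = 1 by subst b; case: ab; rewrite !inE /= ?xpair_eqE ?andbF ?orbF //= => /eqP.
    exists (start sG j); first by rewrite Ex a1 o4.
    by left; apply: (@old_inj _ s 4 kite); rewrite E b0 cp_start.
  + by case/eqP: (@cp_neq_old _ _ 4 kite sG j b v ib).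
  + by have := old_neq_root s 4 kite v; rewrite E b5 (cp_root _ _ sG) eqxx.
Qed.

Lemma max_cut_kite : max_cut X = max_cut G + (5 * P + 1).
Proof.
have cutX (S : {set vertex X}) :
    cut_size S = cut_size [set u | old u \in S] + ((rootv \in S) (+) (pendv \in S)) +
      \sum_(j < P) count (fun e => (cp j e.1 \in S) (+) (cp j e.2 \in S)) kite.
  rewrite (cut_size_attach sG kite_ok) /= (cut_size_edge_list sG) count_map.
  by congr (_ + _ + _); apply: eq_count => p /=; rewrite !inE.
apply/eqP; rewrite eqn_leq; apply/andP; split.
  apply/bigmax_leqP => S _; rewrite cutX (addnC (5 * P)) addnA; apply: leq_add.
    by apply: leq_add; [apply: (leq_bigmax (F := @cut_size G))|case: (_ (+) _)].
  (* At most five of the six edges of a kite are cut, since a triangle is never cut entirely. *)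
  apply: (@leq_trans (\sum_(j < P) 5)); last by rewrite sum_nat_const card_ord mulnC.
  apply: leq_sum => j _ /=.
  by case: (cp j 0 \in S); case: (cp j 1 \in S); case: (cp j 2 \in S);
    case: (cp j 3 \in S); case: (cp j 4 \in S); case: (cp j 5 \in S).
apply: (@leq_trans (max_cut G + 1 + \sum_(j < P) 5)).
  by rewrite sum_nat_const card_ord; lia.
have [S0 ->] : exists S0 : {set vertex G}, max_cut G = cut_size S0.
  have [|S0 ES] := @bigop.eq_bigmax _ (@cut_size G); last by exists S0.
  by apply/card_gt0P; exists set0.
(* Five edges are reached for either side of the start: $x$ is opposite to $v$, $z$ to the root, $y$
   to $z$ and $y'$ to $y$; then exactly one of $xy$ and $xz$ is cut. *)
have [F [o1 o2 o3 o4]] := attach_rec 4 kite (fun u => u \in S0) false true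
  (fun j a => if a == 1 then start sG j \notin S0 else a != 2) sG.
apply: leq_trans (leq_bigmax [set x | F x]).
rewrite cutX !inE o2 o3 leq_add //.
  by rewrite leq_add // (_ : [set u | _] = S0) //; apply/setP => u; rewrite !inE o1.
apply: leq_sum => j _; pose m a := cp j a \in [set x | F x].
have m0 : m 0 = (start sG j \in S0) by rewrite /m inE cp_start o1.
have m5 : m 5 = false by rewrite /m inE (cp_root _ _ sG) o2.
rewrite -[count _ _]/(count (fun e => m e.1 (+) m e.2) kite) /= m0 m5 /m !inE !o4 //=.
by case: (_ \in S0).
Qed.

End Kite.

(** * Subgraphs without pendant vertices *)

Definition path_pattern (q : nat) : seq (nat * nat) := [seq (i, i.+1) | i <- iota 0 q.+1].

Lemma mem_path_pattern q a b : ((a, b) \in path_pattern q) = (a <= q) && (b == a.+1).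
Proof.
apply/mapP/andP => [[i + [-> ->]]|[aq /eqP->]]; first by rewrite mem_iota eqxx.
by exists a; rewrite ?mem_iota.
Qed.

Lemma path_pattern_ok q : 0 < q -> pattern_ok q (path_pattern q).
Proof.
move=> q0; apply/and3P; split.
- by rewrite map_inj_uniq ?iota_uniq // => i j [].
- by apply/allP => -[a b]; rewrite !mem_path_pattern /= => /andP[aq /eqP->]; lia.
- apply/allP => -[a b]; rewrite mem_path_pattern /inner /= => /andP[aq /eqP->]; lia.
Qed.

Lemma path_pattern_connected q : pattern_connected q (path_pattern q).
Proof.
move=> S Sq a aq Sa; apply: contraT => /hasPn H.
have step i : i <= q -> S i.+1 = S i.
  move=> iq; have := H (i, i.+1); rewrite mem_path_pattern iq eqxx => /(_ isT) /=.
  by case: (S i); case: (S i.+1).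
have up i : a + i <= q.+1 -> S (a + i).
  elim: i => [|i IH]; rewrite ?addn0 // addnS => h.
  by rewrite step ?IH //; lia.
by have := up (q.+1 - a); rewrite subnKC ?Sq; [apply|lia].
Qed.

Section Path.
Variables (G : sgraph) (s : seq (vertex G * vertex G)) (q : nat).
Hypothesis sG : edge_list s.
Hypothesis q_gt0 : 0 < q.

Let X := attach s q (path_pattern q).
Let ok := path_pattern_ok q_gt0.
Local Notation P := (ncopies G).
Local Notation old := (old s q (path_pattern q)).
Local Notation rootv := (rootv s q (path_pattern q)).
Local Notation pendv := (pendv s q (path_pattern q)).
Local Notation cp := (cp s q (path_pattern q)).

Lemma adj_path_cp j a (y : vertex X) : inner q a -> adj (cp j a) y ->
  y = cp j a.-1 \/ y = cp j a.+1.
Proof.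
move=> ia; case/(adj_cases sG ok) => [[u [v [_ E _]]]|[E _]|[E _]|].
- by case/eqP: (cp_neq_old (path_pattern q) sG j u ia).
- by case/eqP: (cp_neq_root (path_pattern q) sG j ia).
- by case/eqP: (cp_neq_pend (path_pattern q) sG j ia).
case=> j' [a' [b [ab E ->]]].
have la' : a' <= q.+1 by case: ab => /(pat_lt ok)[].
have [<- Ea] := cp_inj sG ia la' E; move: ab; rewrite -Ea !mem_path_pattern.
by case=> /andP[_ /eqP->]; [right|left].
Qed.

(* Following degree-2 vertices, a subgraph that enters a path contains all of it. *)
Lemma two_neighbours_old (F : {set vertex X}) : #|F| < q ->
  (forall x, x \in F ->
     exists y z, [/\ y \in F, z \in F, y != z, adj x y & adj x z]) ->
  forall x, x \in F -> exists u, x = old u.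
Proof.
move=> Fq deg2.
have nxt j a : inner q a -> cp j a \in F -> cp j a.-1 \in F /\ cp j a.+1 \in F.
  move=> ia /deg2[y [z [yF zF yz /(adj_path_cp ia) Ey /(adj_path_cp ia) Ez]]].
  case: Ey Ez yz yF zF => -> [] -> //; by rewrite eqxx.
have cpF j a : inner q a -> cp j a \notin F.
  move=> ia; apply/negP => aF; have /andP[a0 aq] := ia.
  have up i : a + i <= q.+1 -> cp j (a + i) \in F.
    elim: i => [|i IH] h; first by rewrite addn0.
    have [||_] := nxt j (a + i); [by rewrite /inner; lia|by apply: IH; lia|].
    by rewrite addnS.
  (* Truncated subtraction lets the descent rest at node 0. *)
  have dn i : cp j (a - i) \in F.
    elim: i => [|i IH]; first by rewrite subn0.
    rewrite subnS; have [E|ai] := posnP (a - i); first by rewrite E in IH *.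
    by have [|//|] := nxt j (a - i); first by rewrite /inner; lia.
  have all b : b <= q.+1 -> cp j b \in F.
    have [ba|ab] := leqP b a => bq; first by have := dn (a - b); rewrite subKn.
    by have := up (b - a); rewrite subnKC ?(ltnW ab) //; apply.
  (* All [q] inner nodes of the path would lie in [F], against its size. *)
  have : #|[set cp j b.+1 | b : 'I_q]| <= #|F|.
    by apply: subset_leq_card; apply/subsetP => _ /imsetP[b _ ->];
      apply: all; have := ltn_ord b; lia.
  rewrite card_imset ?card_ord; first by lia.
  move=> b b' E; apply: val_inj; apply: succn_inj.
  by apply: (cp_inj_copy sG _ _ E); have := ltn_ord b; have := ltn_ord b'; lia.
have pF : pendv \notin F.
  apply/negP => /deg2[y [z [_ _ /eqP yz py pz]]]; apply: yz.
  have nb w : adj pendv w -> w = rootv.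
    case/(adj_cases sG ok) => [[u [v [_ E _]]]|[E _]|[_ //]|[j [a [b [ab E _]]]]].
    - by have := old_neq_pend s q (path_pattern q) u; rewrite -E eqxx.
    - by have := root_neq_pend s q (path_pattern q); rewrite -E eqxx.
    have la : a <= q.+1 by case: ab => /(pat_lt ok)[].
    case: (inner_cases la) => [a0|ia|aq].
    - by have := old_neq_pend s q (path_pattern q) (start sG j); rewrite E a0 cp_start eqxx.
    - by case/eqP: (cp_neq_pend (path_pattern q) sG j ia).
    - by have := root_neq_pend s q (path_pattern q); rewrite E aq (cp_root _ _ sG) eqxx.
  by rewrite (nb y) // (nb z).
(* The neighbours of the root are the pendant vertex and the last inner nodes of the paths, all
   excluded by now. *)
have rF : rootv \notin F.
  apply/negP => /deg2[y [_ [yF _ _ ry _]]].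
  case/(adj_cases sG ok): ry => [[u [v [_ E _]]]|[_ E]|[E _]|[j [a [b [ab E Ey]]]]].
  - by have := old_neq_root s q (path_pattern q) u; rewrite -E eqxx.
  - by rewrite -E yF in pF.
  - by have := root_neq_pend s q (path_pattern q); rewrite -E eqxx.
  have la : a <= q.+1 by case: ab => /(pat_lt ok)[].
  case: (inner_cases la) => [a0|ia|aq].
  - by have := old_neq_root s q (path_pattern q) (start sG j); rewrite E a0 cp_start eqxx.
  - by case/eqP: (cp_neq_root (path_pattern q) sG j ia).
  - case: ab; rewrite aq mem_path_pattern ?ltnn // => /andP[bq /eqP[qb]].
    by have := cpF j b; rewrite -Ey yF => /(_ _); rewrite /inner -qb q_gt0 leqnn => /(_ isT).
move=> x xF; case: (vertex_cases sG x) => [//|E|E|[j [a [ia E]]]].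
- by rewrite -E xF in rF.
- by rewrite -E xF in pF.
- by have := cpF j a ia; rewrite -E xF.
Qed.

(** Three vertices are fewer than [q], and each has the other two as neighbours. *)
Lemma triangle_old : 3 < q ->
  forall x y z : vertex X, adj x y -> adj y z -> adj x z -> exists u, x = old u.
Proof.
move=> q3 x y z xy yz xz.
have nxy := adj_neq xy; have nyz := adj_neq yz; have nxz := adj_neq xz.
apply: (@two_neighbours_old [set x; y; z]); last by rewrite !inE eqxx.
  apply: leq_ltn_trans q3; apply: leq_trans (leq_card_setU _ _) _.
  by rewrite cards1 cards2 addn1 ltnS; case: (_ != _).
move=> w; rewrite !inE -orbA => /or3P[]/eqP->.
- by exists y, z; rewrite !inE !eqxx ?orbT.
- by exists x, z; rewrite !inE !eqxx ?orbT adj_sym.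
- by exists x, y; rewrite !inE !eqxx ?orbT adj_sym (adj_sym z).
Qed.

End Path.

Lemma injection_extend (A B : finType) (U : {set A}) (g : A -> B) :
  #|A| <= #|B| -> {in U &, injective g} ->
  exists h : A -> B, injective h /\ {in U, h =1 g}.
Proof.
move=> leAB gI; have [A0|/card_gt0P[a0 _]] := posnP #|A|.
  have noA (a : A) : False by have := fintype0 a A0.
  by exists g; split=> [a|a]; case: (noA a).
pose C := enum (~: U); pose D := enum (~: (g @: U)).
have le : size C <= size D.
  rewrite -!cardE; have := cardsC U; have := cardsC (g @: U); rewrite card_in_imset //.
  by lia.
pose h a := if a \in U then g a else nth (g a0) D (index a C).
have hD a : a \notin U -> index a C < size D.
  by move=> aU; apply: leq_trans le; rewrite index_mem mem_enum inE.
have hU a : a \notin U -> h a \notin g @: U.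
  move=> aU; rewrite /h (negbTE aU).
  by have := mem_nth (g a0) (hD a aU); rewrite mem_enum inE.
exists h; split=> [a b|a aU]; last by rewrite /h aU.
have [aU|aU] := boolP (a \in U); have [bU|bU] := boolP (b \in U).
- by rewrite /h aU bU; apply: gI.
- by move=> E; have := hU b bU; rewrite -E /h aU imset_f.
- by move=> E; have := hU a aU; rewrite E /h bU imset_f.
rewrite /h (negbTE aU) (negbTE bU) => /eqP; rewrite nth_uniq ?enum_uniq ?hD //.
by move=> /eqP/index_inj -> //; rewrite mem_enum inE.
Qed.

Definition embedding (H G : sgraph) (g : vertex H -> vertex G) : Prop :=
  injective g /\ forall u v, adj u v -> adj (g u) (g v).

Lemma subgraph_detectionP (H G : sgraph) :
  reflect (exists g : vertex H -> vertex G, embedding g) (subgraph_detection H G == 1).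
Proof.
rewrite /subgraph_detection eqb1; apply: (iffP existsP) => -[g].
  case/andP => /injectiveP gI /forallP gA; exists g; split=> // u v uv.
  by have /forallP/(_ v) := gA u; rewrite uv.
case=> gI gA; exists [ffun x => g x]; apply/andP; split.
  by apply/injectiveP => x y; rewrite !ffunE => /gI.
by apply/forallP => u; apply/forallP => v; apply/implyP => /gA; rewrite !ffunE.
Qed.

Lemma subgraph_detection_bool H G : subgraph_detection H G = (subgraph_detection H G == 1).
Proof. by rewrite /subgraph_detection; case: [exists _, _]. Qed.

(** A non-isolated vertex of [H] has two neighbours, so its image is old, the paths having more
    inner nodes than [H] has vertices. Isolated vertices can be moved into [G] if there is room; the
    second factor tests this, as new vertices could feign it. *)
Lemma subgraph_detection_path (H G : sgraph) (s : seq (vertex G * vertex G)) :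
  edge_list s -> no_pendant H ->
  subgraph_detection H G =
  subgraph_detection H (attach s (nv H).+1 (path_pattern (nv H).+1)) * (nv H < nv G + 1).
Proof.
move=> sG npH; set q := (nv H).+1; set X := attach _ _ _.
have ok := path_pattern_ok (ltn0Sn (nv H)).
rewrite [LHS]subgraph_detection_bool [in RHS]subgraph_detection_bool mulnb addn1 ltnS.
congr nat_of_bool; apply/subgraph_detectionP/andP => [[g [gI gA]]|].
  split; last by have := leq_card g gI; rewrite !card_ord.
  apply/subgraph_detectionP; exists (fun u => old s q (path_pattern q) (g u)).
  split=> [u v /old_inj/gI //|u v /gA]; by rewrite (adj_old sG ok).
case=> /subgraph_detectionP[f [fI fA]] leHG.
pose U := [set u : vertex H | deg u != 0].
have fU u : u \in U -> exists w, f u = old s q (path_pattern q) w.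
  move=> uU; apply: (@two_neighbours_old _ s q sG (ltn0Sn _) (f @: U)).
  - by rewrite ltnS (leq_trans (leq_imset_card _ _)) // (leq_trans (max_card _)) // card_ord.
  - move=> _ /imsetP[v vU ->].
    have /card_gt1P[a [b [va vb ab]]] : 1 < deg v.
      by move: vU (npH v); rewrite inE; case: (deg v) => [|[|d]].
    have inU w : adj v w -> w \in U.
      by move=> vw; rewrite inE -lt0n; apply/card_gt0P; exists v; rewrite inE adj_sym.
    rewrite !inE in va vb; exists (f a), (f b).
    by rewrite !imset_f ?inU // (inj_eq fI) ab !fA.
  - by rewrite imset_f.
have [g0 g0E] : exists g0 : vertex H -> vertex G,
    {in U, forall u, f u = old s q (path_pattern q) (g0 u)}.
  (* The default is taken only outside [U], where [injection_extend] overrides the choice. *)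
  exists (fun u => odflt (widen_ord leHG u) [pick w | f u == old s q (path_pattern q) w]).
  move=> u /fU[w E]; case: pickP => [w' /eqP //|/(_ w)]; by rewrite E eqxx.
have [||g [gI gE]] := @injection_extend _ _ U g0; first by rewrite !card_ord.
  by move=> u v uU vU E; apply: fI; rewrite !g0E // E.
exists g; split=> // u v uv.
have inU a b : adj a b -> a \in U.
  by move=> ab; rewrite inE -lt0n; apply/card_gt0P; exists b; rewrite inE.
have uU := inU _ _ uv; have vU : v \in U by apply: (inU v u); rewrite adj_sym.
by rewrite !gE // -(adj_old sG ok) -!g0E // fA.
Qed.

(** * Size bounds, decoders and assembly *)

Lemma leq_pow2 x y : x <= y -> x <= 2 ^ y.
Proof. by move=> h; apply: leq_trans h (ltnW (ltn_expl y _)). Qed.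

Lemma cut_size_leq (G : sgraph) (S : {set vertex G}) : cut_size S <= ne G.
Proof. by apply: subset_leq_card; apply/subsetP => e; rewrite inE => /andP[]. Qed.

Lemma clique_counting_leq k (G : sgraph) : clique_counting k G <= 2 ^ (nv G + ne G).
Proof.
apply: leq_trans (subset_leq_card (subsetT _)) _.
by rewrite -powersetT card_powerset cardsT card_ord leq_exp2l // leq_addr.
Qed.

Definition ans : exp := Get 0 (Cst 2).
Definition minus_linear (a : nat) : exp :=
  Op Defs.Sub ans (Op Add (Op Mul (Cst a) copies_exp) (Cst 1)).

Lemma kite_WTER (A : problem) a :
  (forall X, A X <= nv X + ne X) ->
  (forall G (s : seq (vertex G * vertex G)), edge_list s ->
     A (attach s 4 kite) = A G + (a * ncopies G + 1)) ->
  direct_WTER A.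
Proof.
move=> bA eA; apply: (@attach_WTER _ _ A 4 kite (minus_linear a) kite_ok kite_connected) => //.
  by move=> X; apply: leq_pow2.
by move=> G s sG /=; rewrite eA // addnK.
Qed.

Lemma path_WTER (A : problem) (dec : exp) :
  (forall X, A X <= 2 ^ (nv X + ne X)) ->
  (forall G (s : seq (vertex G * vertex G)), edge_list s ->
     val_exp (answer_store (nv G) (ne G) (A (attach s 4 (path_pattern 4)))) dec = A G) ->
  direct_WTER A.
Proof.
move=> bA dA.
exact: (@attach_WTER _ _ A 4 _ dec (path_pattern_ok (ltn0Sn 3)) (@path_pattern_connected 4)).
Qed.

Lemma clique_counting_path G (s : seq (vertex G * vertex G)) k :
  edge_list s -> 2 < k ->
  clique_counting k (attach s 4 (path_pattern 4)) = clique_counting k G.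
Proof.
move=> sG; have ok := path_pattern_ok (ltn0Sn 3).
apply: (clique_counting_triangles (@old_inj _ s 4 _) (adj_old sG ok)).
exact: triangle_old.
Qed.

Lemma max_clique_path G (s : seq (vertex G * vertex G)) :
  edge_list s -> 0 < ne G ->
  max_clique (attach s 4 (path_pattern 4)) = max_clique G.
Proof.
move=> sG; have ok := path_pattern_ok (ltn0Sn 3).
apply: (max_clique_triangles (@old_inj _ s 4 _) (adj_old sG ok)).
exact: triangle_old.
Qed.

(** The new vertices and edges falsify the counts for [k] equal to 1 or 2, which are read off the
    input sizes instead. *)
Definition count_dec (k : nat) : exp :=
  match k with 0 => Cst 1 | 1 => var_n | 2 => var_m | _ => ans end.

Lemma val_count_dec G k x :
  (2 < k -> x = clique_counting k G) ->
  val_exp (answer_store (nv G) (ne G) x) (count_dec k) = clique_counting k G.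
Proof.
case: k => [|[|[|k]]] /= xk; last by rewrite xk.
- by rewrite clique_counting0.
- by rewrite clique_counting1.
- by rewrite clique_counting2.
Qed.

(** Expressions have no conditional, so factors 0 and 1 select the case. An edgeless input is
    decoded from [n], because the root edge is always a clique on two vertices. *)
Definition max_clique_dec : exp :=
  Op Add (Op Mul (Op Lt (Cst 0) var_m) ans)
    (Op Mul (Op Eq var_m (Cst 0)) (Op Lt (Cst 0) var_n)).

Theorem theorem1 :
  direct_WTER max_matching /\
  direct_WTER min_vertex_cover /\
  (forall k : nat, direct_WTER (clique_detection k)) /\
  (forall k : nat, direct_WTER (clique_counting k)) /\
  direct_WTER max_clique /\
  direct_WTER max_cut /\
  direct_WTER min_dominating_set /\
  (forall H : sgraph, no_pendant H ->
     sparse_direct_WTER (subgraph_detection H)).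
Proof.
split; [|split; [|split; [|split; [|split; [|split; [|split]]]]]].
- apply: (@kite_WTER _ 2) => [X|G s sG]; last exact: max_matching_kite.
  apply/bigmax_leqP => M /andP[sub _].
  by apply: leq_trans (subset_leq_card sub) (leq_addl _ _).
- apply: (@kite_WTER _ 2) => [X|G s sG]; last exact: min_vertex_cover_kite.
  by apply: leq_trans (max_card _) _; rewrite card_ord leq_addr.
- move=> k; apply: (@path_WTER _ (Op Lt (Cst 0) (count_dec k))) => [X|G s sG].
    by rewrite /clique_detection; case: [exists _, _]; rewrite ?expn_gt0.
  rewrite !clique_detectionE [LHS]/=; congr nat_of_bool.
  have [k2|k2] := ltnP 2 k.
    rewrite clique_counting_path //; case: k k2 => [|[|[|k]]] //= _.
    by rewrite lt0b.
  by congr (_ < _); apply: val_count_dec; rewrite ltnNge k2.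
- move=> k; apply: (@path_WTER _ (count_dec k)) => [X|G s sG].
    exact: clique_counting_leq.
  by apply: val_count_dec; apply: clique_counting_path.
- apply: (@path_WTER _ max_clique_dec) => [X|G s sG].
    apply/leq_pow2/bigmax_leqP => K _; apply: leq_trans (max_card _) _.
    by rewrite card_ord leq_addr.
  rewrite [LHS]/=; have [m0|m0] := posnP (ne G).
    by rewrite (max_clique_edgeless m0) mul1n.
  by rewrite max_clique_path // mul1n addn0.
- apply: (@kite_WTER _ 5) => [X|G s sG]; last exact: max_cut_kite.
  by apply/bigmax_leqP => S _; apply: leq_trans (cut_size_leq S) (leq_addl _ _).
- apply: (@kite_WTER _ 1) => [X|G s sG]; last by rewrite mul1n min_dominating_set_kite.
  by apply: leq_trans (max_card _) _; rewrite card_ord leq_addr.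
(* The output is sparse whatever the density of the input: a copy brings [q] vertices and
   [q.+1 <= 2 * q] edges, and there are at least [2 * ne G] copies, so the factor 3 suffices without
   any logarithm. *)
- move=> H npH C d; exists 3, 0; set q := (nv H).+1.
  have ok := path_pattern_ok (ltn0Sn (nv H)).
  apply: (@attach_WTER _ _ _ q _ (Op Mul ans (Op Lt (Cst (nv H)) (Op Add var_n (Cst 1))))
    ok (@path_pattern_connected q)) => [X|G s sG|G s sG].
  + by rewrite /subgraph_detection; case: [exists _, _]; rewrite ?expn_gt0.
  + rewrite /sparse /softO expn0 muln1 ne_attach // size_map size_iota /= /q.
    by rewrite /ncopies; nia.
  + by rewrite [RHS](subgraph_detection_path sG npH).
Qed.
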